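(* Let $z=(\{z_i\}_{i\in I},\{z_j\}_{j\in J})$ be a pair of faces (two-faced family) in a non-commutative probability space $(\mathcal A,\varphi)$. Consider the (unbounded) operator on the Fock space $\mathcal F(\mathbb C^{I\sqcup J})$ $$\Theta_z:=1+\sum_{n\ge1}\ \sum_{\alpha:\{1,\dots,n\}\to I\sqcup J}\kappa_\alpha(z)\,T_\alpha,$$ where $1$ is the identity operator, and for $k\in I\sqcup J$ set $Z_k:=L_k^*\Theta_z$. If $T\in\mathrm{alg}(\{Z_k\}_{k\in I\sqcup J})$, then $\langle T\Omega,\Omega\rangle$ is well-defined. Moreover, if $\omega(T)=\langle T\Omega,\Omega\rangle$, then the joint distribution of $\{Z_k\}_{k\in I\sqcup J}$ with respect to $\omega$ is the same as the joint distribution of $z$ with respect to $\varphi$; that is, $\omega(Z_{\alpha(1)}\cdots Z_{\alpha(n)})=\varphi(z_{\alpha(1)}\cdots z_{\alpha(n)})$ for all $n\ge1$ and $\alpha:\{1,\dots,n\}\to I\sqcup J$.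
   Context: A non-commutative probability space $(\mathcal{A},\varphi)$ is a unital complex algebra with a linear functional $\varphi$, $\varphi(1)=1$. $I$ and $J$ are disjoint index sets; $z_k\in\mathcal A$ for $k\in I\sqcup J$ (left if $k\in I$, right if $k\in J$). Cumulants. For $\chi:\{1,\dots,n\}\to\{\ell,r\}$ write $\chi^{-1}(\ell)=\{i_1<\cdots<i_p\}$, $\chi^{-1}(r)=\{j_1<\cdots<j_{n-p}\}$, and let $s_\chi\in S_n$ be $s_\chi(k)=i_k$ for $k\le p$, $s_\chi(k)=j_{n+1-k}$ for $k>p$. $BNC(\chi)$ is the set of partitions $\pi$ of $\{1,\dots,n\}$ such that $s_\chi^{-1}\cdot\pi$ is non-crossing. The functionals $\kappa_\chi:\mathcal A^n\to\mathbb C$ are the multilinear functionals uniquely determined by $\varphi(a_1\cdots a_n)=\sum_{\pi\in BNC(\chi)}\prod_{V\in\pi}\kappa_{\chi|_V}((a_1,\dots,a_n)|V)$ for all $n,\chi$, $a_1,\dots,a_n$, where for $V=\{v_1<\cdots<v_m\}$, $\chi|_V(t)=\chi(v_t)$ and $(a_1,\dots,a_n)|V=(a_{v_1},\dots,a_{v_m})$. For $\alpha:\{1,\dots,n\}\to I\sqcup J$ put $\kappa_\alpha(z)=\kappa_\chi(z_{\alpha(1)},\dots,z_{\alpha(n)})$ with $\chi(k)=\ell$ if $\alpha(k)\in I$ and $\chi(k)=r$ if $\alpha(k)\in J$. Fock space. $\mathcal H=\mathcal F(\mathbb C^{I\sqcup J})=\mathbb C\Omega\oplus\bigoplus_{k\ge1}\bigoplus_{i_1,\dots,i_k\in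 I\sqcup J}\mathbb C(e_{i_1}\otimes\cdots\otimes e_{i_k})$ is the Fock space on a space with orthonormal basis $\{e_k\}_{k\in I\sqcup J}$; these tensors together with $\Omega$ form an orthonormal basis. $\Omega$ is the empty (length zero) tensor: $\xi\otimes\Omega=\xi=\Omega\otimes\xi$, and an empty tensor product is $\Omega$. Tensor products distribute over sums. $L_k$ is the left creation operator $L_k\eta=e_k\otimes\eta$ and $L_k^*$ is its adjoint (left annihilation). Interleaving. $\Sigma(f_1\otimes\cdots\otimes f_a,\,f_{a+1}\otimes\cdots\otimes f_{a+b})=\sum_\sigma f_{\sigma(1)}\otimes\cdots\otimes f_{\sigma(a+b)}$, the sum over all $\sigma\in S_{a+b}$ interleaving the two tensors, i.e. such that $1,\dots,a$ appear in increasing order in the sequence $\sigma(1),\dots,\sigma(a+b)$, and likewise $a+1,\dots,a+b$. In particular $\Sigma(\xi,\Omega)=\xi=\Sigma(\Omega,\xi)$. Operators $T_\alpha$, for $\alpha:\{1,\dots,n\}\to I\sqcup J$, defined on the linear span of the basis tensors. If $n=1$, $T_\alpha=L_{\alpha(1)}$. In general $T_\alpha(\Omega)=L_{\alpha(n)}\cdots L_{\alpha(1)}\Omega=e_{\alpha(n)}\otimes\cdots\otimes e_{\alpha(1)}$. For $n\ge2$, $\alpha(n)\in I$, and $\eta=e_{\beta(m)}\otimes\cdots\otimes e_{\beta(1)}$ with $\beta:\{1,\dots,m\}\to I\sqcup J$, $m\ge1$: (a) if $\beta^{-1}(I)=\emptyset$, let $k=\max(\{0\}\cup\alpha^{-1}(J))$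 and $$T_\alpha(\eta)=e_{\alpha(n)}\otimes\Sigma\big(e_{\alpha(n-1)}\otimes\cdots\otimes e_{\alpha(k+1)},\ e_{\beta(m)}\otimes\cdots\otimes e_{\beta(1)}\big)\otimes e_{\alpha(k)}\otimes\cdots\otimes e_{\alpha(1)};$$ (b) if $\beta^{-1}(I)\ne\emptyset$ and $\alpha(t)\in J$ for some $t$, then $T_\alpha(\eta)=0$; (c) if $\beta^{-1}(I)\neq\emptyset$ and $\alpha(t)\in I$ for all $t$, let $k=\max\beta^{-1}(I)$ and $$T_\alpha(\eta)=e_{\alpha(n)}\otimes\Sigma\big(e_{\alpha(n-1)}\otimes\cdots\otimes e_{\alpha(1)},\ e_{\beta(m)}\otimes\cdots\otimes e_{\beta(k+1)}\big)\otimes e_{\beta(k)}\otimes\cdots\otimes e_{\beta(1)}.$$ If $\alpha(n)\in J$, $T_\alpha$ is defined by the same formulas with the roles of $I$ and $J$ exchanged. Meaning of ''well-defined''. Products of the $Z_k$ are expanded as formal sums: $\langle Z_{\alpha(1)}\cdots Z_{\alpha(n)}\Omega,\Omega\rangle$ is the sum of $\langle A_1\cdots A_n\Omega,\Omega\rangle$ over all choices $A_k\in\{L_{\alpha(k)}^*\}\cup\{\kappa_\beta(z)L_{\alpha(k)}^*T_\beta : m\ge1,\ \beta:\{1,\dots,m\}\to I\sqcup J\}$; it is well-defined in that only finitely many terms are non-zero. This is extended linearly to $\mathrm{alg}(\{Z_k\})$, the algebra generated by the $Z_k$. *)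

(* Defs.v *)
From HB Require Import structures.
From mathcomp Require Import boolp classical_sets functions cardinality fsbigop.
From mathcomp Require Import reals finmap.
From mathcomp Require Import all_boot all_order all_algebra all_fingroup.
From mathcomp Require Import complex.
From mathcomp Require Import monalg.

Set Implicit Arguments.
Unset Strict Implicit.
Unset Printing Implicit Defensive.

Import Order.TTheory GRing.Theory Num.Theory.
Local Open Scope ring_scope.

(* A map chi : {1, ..., n} -> {l, r} is a map 'I_n -> bool, [true] being l;
   indices are shifted to 0, ..., n-1. *)
Section BiNonCrossing.
Context (n : nat) (chi : 'I_n -> bool).

Definition s_chi_seq : seq 'I_n :=
  [seq i <- enum 'I_n | chi i] ++ rev [seq i <- enum 'I_n | ~~ chi i].

Definition s_chi_fun (k : 'I_n) : 'I_n := nth k s_chi_seq k.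

Lemma s_chi_inj : injective s_chi_fun.
Proof.
have ps : perm_eq s_chi_seq (enum 'I_n).
  apply: perm_trans (permEl (perm_filterC chi (enum 'I_n))).
  by rewrite perm_cat2l perm_rev.
have us : uniq s_chi_seq by rewrite (perm_uniq ps) enum_uniq.
have ss : size s_chi_seq = n by rewrite (perm_size ps) size_enum_ord.
move=> i j; rewrite /s_chi_fun (set_nth_default i j) ?ss //.
by move/eqP; rewrite nth_uniq ?ss // => /eqP/val_inj.
Qed.

Definition s_chi : 'S_n := perm s_chi_inj.

Definition noncrossing (p : {set {set 'I_n}}) : bool :=
  [forall V in p, forall W in p,
    [exists a in V, exists b in W, exists c in V, exists d in W,
       [&& (a < b)%N, (b < c)%N & (c < d)%N]] ==> (V == W)].

Definition BNC : {set {set {set 'I_n}}} :=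
  [set p | partition p [set: 'I_n]
         & noncrossing [set (s_chi^-1)%g @: (V : {set 'I_n}) | V in p]].

End BiNonCrossing.

(* [restr f V] is the subsequence (f_{v_1}, ..., f_{v_m}) of f attached to
   V = {v_1 < ... < v_m}: [enum_val] enumerates V in increasing order. *)
Definition restr (n : nat) (X : Type) (f : 'I_n -> X) (V : {set 'I_n}) :
  'I_#|V| -> X := fun t => f (enum_val t).
Arguments restr {n X} f V _.

Section Cumulants.
Context (R : realType) (A : algType R[i]) (phi : {scalar A}).

Definition functionals :=
  forall n : nat, ('I_n -> bool) -> ('I_n -> A) -> R[i].

Definition multilinear_functionals (kappa : functionals) : Prop :=
  forall n (chi : 'I_n -> bool) (a : 'I_n -> A) (i : 'I_n),
    scalar (fun x : A => kappa n chi (fun j => if j == i then x else a j)).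

Definition moment_cumulant (kappa : functionals) : Prop :=
  forall n (chi : 'I_n -> bool) (a : 'I_n -> A),
    phi (\prod_(i < n) a i) =
    \sum_(p in BNC chi) \prod_(V in p) kappa #|V| (restr chi V) (restr a V).

Definition bifree_cumulants (kappa : functionals) : Prop :=
  multilinear_functionals kappa /\ moment_cumulant kappa.

(* Existence of the cumulants; they are unique for n >= 1, and kappa 0, which
   no formula involves, is unconstrained. *)
Fixpoint kfuel (N n : nat) (chi : 'I_n -> bool) (a : 'I_n -> A) : R[i] :=
  phi (\prod_(i < n) a i) -
  if N is N'.+1 then
    \sum_(p in BNC chi | p != [set [set: 'I_n]])
      \prod_(V in p) kfuel N' (restr chi V) (restr a V)
  else 0.

Lemma block_gt0 n (p : {set {set 'I_n}}) V :
  partition p [set: 'I_n] -> V \in p -> (0 < #|V|)%N.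
Proof.
case/and3P=> _ _ p0 Vp; rewrite card_gt0.
by apply: contraNneq p0 => <-.
Qed.

Lemma block_lt n (p : {set {set 'I_n}}) V :
  partition p [set: 'I_n] -> p != [set [set: 'I_n]] -> V \in p ->
  (#|V| < n)%N.
Proof.
move=> pP pT Vp; rewrite -[X in (_ < X)%N](card_ord n) -cardsT.
apply: proper_card; rewrite properT; apply: contra_neq pT => VT.
apply/setP => W; rewrite inE; apply/idP/eqP => [Wp|->]; last by rewrite -VT.
have /set0Pn[x xW] : W != set0 by rewrite -card_gt0 (block_gt0 pP).
case/and3P: pP => _ tI _.
by rewrite -(def_pblock tI Wp xW) (def_pblock tI Vp) // VT inE.
Qed.

Lemma kfuel_eq N M n (chi : 'I_n -> bool) (a : 'I_n -> A) :
  (0 < n)%N -> (n <= N)%N -> (n <= M)%N -> kfuel N chi a = kfuel M chi a.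
Proof.
elim: N M n chi a => [|N IH] [|M] n chi a n0 nN nM;
  try by move: n0; (rewrite lt0n -leqn0 ?nN ?nM).
rewrite /=; congr (_ - _); apply: eq_bigr => p /andP[].
rewrite inE => /andP[pP _] pT; apply: eq_bigr => V Vp.
have Vn := block_lt pP pT Vp.
apply: IH; first exact: block_gt0 pP Vp.
- by rewrite -ltnS (leq_trans Vn).
- by rewrite -ltnS (leq_trans Vn).
Qed.

Lemma prod_scalar (T : eqType) (r : seq T) (a : T -> A) (i : T) :
  uniq r -> i \in r -> forall (c : R[i]) (x y : A),
  \prod_(j <- r) (if j == i then c *: x + y else a j) =
  c *: \prod_(j <- r) (if j == i then x else a j) +
  \prod_(j <- r) (if j == i then y else a j).
Proof.
elim: r => // h r IH /= /andP[hr ur]; rewrite inE => ir c x y.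
rewrite !big_cons [h == i]eq_sym; case: (eqVneq i h) ir => [ih _|_ /= ir].
  have E w : \prod_(j <- r) (if j == i then w else a j) = \prod_(j <- r) a j.
    apply: eq_big_seq => j jr; case: eqP => // ji.
    by move: hr; rewrite -ih -ji jr.
  by rewrite !E mulrDl scalerAl.
by rewrite IH // mulrDr scalerAr.
Qed.

Lemma kfuel_scalar N n (chi : 'I_n -> bool) (a : 'I_n -> A) (i : 'I_n) :
  scalar (fun x : A => kfuel N chi (fun j => if j == i then x else a j)).
Proof.
elim: N n chi a i => [|N IH] n chi a i c x y.
  rewrite /= !subr0 prod_scalar ?index_enum_uniq ?mem_index_enum //.
  by rewrite linearP.
rewrite /= prod_scalar ?index_enum_uniq ?mem_index_enum // linearP.
rewrite mulrBr addrACA -opprD; congr (_ - _).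
rewrite mulr_sumr -big_split; apply: eq_bigr => p /andP[].
rewrite inE => /andP[/and3P[/eqP cov tI p0] _] _.
have icov : i \in cover p by rewrite cov inE.
set V0 := pblock p i.
have V0p : V0 \in p by rewrite pblock_mem.
have iV0 : i \in V0 by rewrite mem_pblock.
have other w V : V \in p -> V != V0 ->
    restr (fun j => if j == i then w else a j) V = restr a V.
  move=> Vp VV; apply/funext => t; rewrite /restr; case: eqP => // ti.
  by case/eqP: VV; rewrite /V0 -ti (def_pblock tI Vp (enum_valP t)).
have mine w : restr (fun j => if j == i then w else a j) V0 =
    (fun t => if t == enum_rank_in iV0 i then w else restr a V0 t).
  apply/funext => t; rewrite /restr; congr (if _ then _ else _).
  apply/eqP/eqP => [ti|->]; last by rewrite enum_rankK_in.
  by apply: enum_val_inj; rewrite ti enum_rankK_in.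
rewrite /= !(bigD1 V0 V0p) /= !mine IH mulrDl mulrA.
by congr (_ * _ * _ + _ * _); apply: eq_bigr => V /andP[Vp VV];
  rewrite !other.
Qed.

Lemma restr_setT (F : functionals) n (chi : 'I_n -> bool) (a : 'I_n -> A) :
  F _ (restr chi [set: 'I_n]) (restr a [set: 'I_n]) = F n chi a.
Proof.
have e : #|[set: 'I_n]| = n by rewrite cardsT card_ord.
have E (X : Type) (f : 'I_n -> X) : restr f [set: 'I_n] = f \o cast_ord e.
  apply/funext => t; rewrite /restr /=; congr f; apply/val_inj => /=.
  rewrite (enum_val_nth (cast_ord e t)) enum_setT -enumT /=.
  by rewrite nth_enum_ord // -[X in (_ < X)%N]e.
have castF m (e' : m = n) :
    F m (chi \o cast_ord e') (a \o cast_ord e') = F n chi a.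
  by case: n / e' chi a {e E} => chi a;
    congr (F _ _ _); apply/funext => t; rewrite /= cast_ord_id.
by rewrite !E castF.
Qed.

Lemma setT_BNC n (chi : 'I_n -> bool) :
  (0 < n)%N -> [set [set: 'I_n]] \in BNC chi.
Proof.
move=> n0; rewrite inE; apply/andP; split.
  apply/and3P; split; first by rewrite /cover big_set1.
    by apply/trivIsetP => V W; rewrite !inE => /eqP-> /eqP->; rewrite eqxx.
  by rewrite inE eq_sym -card_gt0 cardsT card_ord.
apply/forall_inP => V /imsetP[V' V'T ->]; apply/forall_inP => W /imsetP[W' W'T ->].
move: V'T W'T; rewrite !inE => /eqP-> /eqP->.
by rewrite eqxx implybT.
Qed.

Lemma bifree_cumulants_exist :
  phi 1 = 1 -> exists kappa, bifree_cumulants kappa.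
Proof.
move=> phi1; exists (fun n => @kfuel n n); split.
  by move=> n chi a i; apply: kfuel_scalar.
case=> [|n] chi a.
  have set0P (p : {set {set 'I_0}}) : partition p [set: 'I_0] -> p = set0.
    move=> pP; apply/setP => V; rewrite inE; apply/negP => Vp.
    have := block_gt0 pP Vp; rewrite card_gt0 => /set0Pn[x _].
    by case: x.
  have P0 : set0 \in BNC chi.
    rewrite inE; apply/andP; split.
      apply/and3P; split; last by rewrite in_set0.
        by rewrite /cover big_set0; apply/eqP/setP; case.
      by apply/trivIsetP => V W; rewrite in_set0.
    by rewrite imset0; apply/forall_inP => V; rewrite in_set0.
  rewrite big_ord0 phi1 (bigD1 set0) //= big_set0 big1 ?addr0 // => p.
  by rewrite inE => /andP[/andP[/set0P-> _]]; rewrite eqxx.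
rewrite (bigD1 _ (setT_BNC chi (ltn0Sn n))) /= big_set1.
rewrite (restr_setT (fun n => @kfuel n n)) /=.
rewrite -[LHS](subrK (\sum_(p in BNC chi | p != [set [set: 'I_n.+1]])
  \prod_(V in p) kfuel n (restr chi V) (restr a V))).
congr (_ + _).
apply: eq_bigr => p /andP[]; rewrite [_ \in BNC _]inE => /andP[pP _] pT.
apply: eq_bigr => V Vp; apply: kfuel_eq => //; first exact: block_gt0 pP Vp.
by rewrite -ltnS (block_lt pP pT).
Qed.

End Cumulants.

Section FockSpace.
Context (R : realType) (K : choiceType).

(* The span of the basis tensors (on which all the operators are defined): the
   word [:: i_1; ...; i_k] stands for e_{i_1} (x) ... (x) e_{i_k}. *)
Definition fock := {malg R[i][seq K]}.

Definition etens (w : seq K) : fock := << 1 *g w >>.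

Definition vacuum : fock := etens [::].

Definition inner (x y : fock) : R[i] :=
  \sum_(w <- msupp x) x@_w * (y@_w)^*.

Definition linext (f : seq K -> fock) (x : fock) : fock :=
  \sum_(w <- msupp x) x@_w *: f w.

Definition tens (x y : fock) : fock :=
  linext (fun u => linext (fun v => etens (u ++ v)) y) x.

Definition creation (k : K) (x : fock) : fock := tens (etens [:: k]) x.

(* This is the adjoint of creation: see [innerLstar]. *)
Definition annihilation (k : K) : fock -> fock :=
  linext (fun w => if w is h :: t then (if h == k then etens t else 0) else 0).

Lemma linext_supp (f : seq K -> fock) (x : fock) (d : {fset seq K}) : {subset msupp x <= d} ->
  linext f x = \sum_(w <- d) x@_w *: f w.
Proof.
move=> xd; rewrite /linext (big_fset_incl _ (B := d)) //.
  by apply/fsubsetP.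
by move=> w _ wx; rewrite mcoeff_outdom // scale0r.
Qed.

Lemma linext_coeff (f : seq K -> fock) (x : fock) (w : seq K) :
  (linext f x)@_w = \sum_(u <- msupp x) x@_u * (f u)@_w.
Proof. by rewrite raddf_sum; apply: eq_bigr => u _; rewrite /= mcoeffZ. Qed.

Lemma inner_supp (x y : fock) (d : {fset seq K}) : {subset msupp x <= d} ->
  inner x y = \sum_(w <- d) x@_w * (y@_w)^*.
Proof.
move=> xd; rewrite /inner (big_fset_incl _ (B := d)) //.
  by apply/fsubsetP.
by move=> w _ wx; rewrite mcoeff_outdom // mul0r.
Qed.

Lemma creation_coeff k (x : fock) w :
  (creation k x)@_w = if w is h :: t then (if h == k then x@_t else 0) else 0.
Proof.
rewrite /creation /tens linext_coeff /etens msuppU oner_eq0 big_seq_fset1 mcoeffUU mul1r.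
rewrite linext_coeff (eq_bigr (fun u => x@_u * (k :: u == w)%:R)); last first.
  by move=> u _; rewrite mcoeffU.
case: w => [|h t]; first by rewrite big1 // => u _; rewrite mulr0.
rewrite (eq_bigr (fun u => if (u == t) && (h == k) then x@_u else 0)).
  case: (h == k); last by rewrite big1 // => u _; rewrite andbF.
  case: (boolP (t \in msupp x)) => xt; last first.
    rewrite mcoeff_outdom // big1_seq // => u /= ux.
    by case: eqP => // ut; rewrite -ut ux in xt.
  rewrite (big_fsetD1 t) //= eqxx big1_seq ?addr0 // => u /=.
  by rewrite in_fsetD1 => /andP[/negPf-> _].
move=> u _; rewrite eqseq_cons andbC [h == k]eq_sym.
by case: (_ && _); rewrite ?mulr1 ?mulr0.
Qed.

Lemma annihilation_coeff k (y : fock) w : (annihilation k y)@_w = y@_(k :: w).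
Proof.
rewrite linext_coeff (eq_bigr (fun u => if u == k :: w then y@_u else 0)).
  case: (boolP (k :: w \in msupp y)) => ykw; last first.
    rewrite mcoeff_outdom // big1_seq // => u /= uy.
    by case: eqP => // e; rewrite -e uy in ykw.
  rewrite (big_fsetD1 (k :: w)) //= eqxx big1_seq ?addr0 // => u /=.
  by rewrite in_fsetD1 => /andP[/negPf-> _].
move=> [|h t] _; first by rewrite mcoeff0 mulr0.
rewrite eqseq_cons; case: (h == k); rewrite ?mcoeff0 ?mulr0 //= mcoeffU.
by case: (t == w); rewrite ?mulr1 ?mulr0.
Qed.

Lemma innerLstar k (x y : fock) :
  inner (creation k x) y = inner x (annihilation k y).
Proof.
rewrite (@inner_supp _ _ [fset k :: t | t in msupp x]%fset).
  rewrite big_imfset /=; last by move=> u v _ _ [].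
  by apply: eq_bigr => w _; rewrite creation_coeff eqxx annihilation_coeff.
move=> w; rewrite -mcoeff_neq0 creation_coeff.
case: w => [|h t]; first by rewrite eqxx.
case: (eqVneq h k) => [->|_]; last by rewrite eqxx.
by rewrite mcoeff_neq0 => tx; apply/imfsetP; exists t.
Qed.

End FockSpace.

Section Operators.
Context (R : realType) (I J : choiceType).
Local Notation K := (I + J)%type.
Local Notation fock := (fock R K).
Local Notation etens := (@etens R K).

Definition side (k : K) : bool := if k is inl _ then true else false.

(* sigma lists the positions of the letters of u ++ v; it interleaves when the
   positions < size u, resp. >= size u, are listed in increasing order. *)
Definition interleaves (a n : nat) (sigma : 'S_n) : bool :=
  [forall s, forall t,
     [&& (sigma s < sigma t)%N & (sigma t < a)%N || (a <= sigma s)%N]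
       ==> (s < t)%N].

Definition Sigma (u v : seq K) : fock :=
  \sum_(sigma : 'S_(size (u ++ v)) | interleaves (size u) sigma)
    etens [seq tnth (in_tuple (u ++ v)) (sigma t) | t <- enum 'I_(size (u ++ v))].

(* T_alpha eta for a word alpha = [:: alpha(1); ...; alpha(n)] and a basis
   tensor eta = [:: beta(m); ...; beta(1)].  As tensors are written with
   decreasing indices, a maximal index k such that alpha(k) (or beta(k)) lies
   on a given side is the first occurrence of that side in [rev alpha] (or in
   eta); [find] returns the number of letters before it.  In the last two
   branches "same" and "opp" refer to the side of alpha(n), which handles
   alpha(n) \in I and alpha(n) \in J at once.  The value for the empty alpha is
   irrelevant. *)
Definition T_basis (alpha eta : seq K) : fock :=
  if rev alpha is a :: ra then
    let same k := side k == side a in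
    let opp k := side k != side a in
    if eta == [::] then etens (rev alpha)
    else if size alpha == 1%N then creation a (etens eta)
    else if ~~ has same eta then
      let k := find opp ra in
      tens (tens (etens [:: a]) (Sigma (take k ra) eta)) (etens (drop k ra))
    else if has opp alpha then 0
    else
      let k := find same eta in
      tens (tens (etens [:: a]) (Sigma ra (take k eta))) (etens (drop k eta))
  else 0.

Definition T_op (alpha : seq K) : fock -> fock := linext (T_basis alpha).

(* Formal sums of products of the operators L_k^* and T_alpha: a product is a
   word in the symbols [inl k] (for L_k^* ) and [inr alpha] (for T_alpha), and
   a formal, possibly infinite, sum is its coefficient function; sum and
   scaling are pointwise. *)
Definition opsym := (K + seq K)%type.

Definition fsum := seq opsym -> R[i].

Definition fsum1 : fsum := fun u => (u == [::])%:R.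

Definition fsum_sym (x : opsym) : fsum := fun u => (u == [:: x])%:R.

Definition fsum_mul (F G : fsum) : fsum :=
  fun u => \sum_(i < (size u).+1) F (take i u) * G (drop i u).

Inductive fsum_alg (gen : K -> fsum) : fsum -> Prop :=
| fsum_alg1 : fsum_alg gen fsum1
| fsum_alg_gen k : fsum_alg gen (gen k)
| fsum_algD F G : fsum_alg gen F -> fsum_alg gen G -> fsum_alg gen (F + G)
| fsum_algZ (c : R[i]) F : fsum_alg gen F -> fsum_alg gen (c *: F)
| fsum_algM F G :
    fsum_alg gen F -> fsum_alg gen G -> fsum_alg gen (fsum_mul F G).

Definition op_of_sym (x : opsym) : fock -> fock :=
  match x with inl k => annihilation k | inr alpha => T_op alpha end.

Definition op_of_word (u : seq opsym) : fock -> fock :=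
  fun x => foldr op_of_sym x u.

Definition vacuum_term (F : fsum) (u : seq opsym) : R[i] :=
  F u * inner (op_of_word u (vacuum R K)) (vacuum R K).

Definition vacuum_well_defined (F : fsum) : Prop :=
  finite_set [set u | vacuum_term F u != 0]%classic.

(* <F Omega, Omega>; only meaningful when [vacuum_well_defined F]. *)
Definition omega (F : fsum) : R[i] :=
  \sum_(u \in [set: seq opsym]%classic) vacuum_term F u.

Context (A : algType R[i]) (kappa : functionals A) (z : K -> A).

Definition kappa_word (alpha : seq K) : R[i] :=
  kappa (fun k => side (tnth (in_tuple alpha) k))
        (fun k => z (tnth (in_tuple alpha) k)).

Definition Theta : fsum := fun u =>
  match u with
  | [::] => 1
  | [:: inr alpha] => if alpha == [::] then 0 else kappa_word alpha
  | _ => 0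
  end.

Definition Z (k : K) : fsum := fsum_mul (fsum_sym (inl k)) Theta.

End Operators.

(* Main.v *)
Require Import Defs.
From HB Require Import structures.
From mathcomp Require Import boolp classical_sets functions cardinality fsbigop.
From mathcomp Require Import finmap.
From mathcomp Require Import all_boot all_order all_algebra all_fingroup.
From mathcomp Require Import complex reals.
From mathcomp Require Import monalg zify.

Set Implicit Arguments.
Unset Strict Implicit.
Unset Printing Implicit Defensive.

Import Order.TTheory GRing.Theory Num.Theory.
Local Open Scope ring_scope.

(** The product Z_(alpha 1) ... Z_(alpha n) is applied to the vacuum from the
    right, so the positions n, n-1, ..., 1 are met in this order. Read a basis
    tensor met on the way as the list of open positions: those that are still to
    be annihilated and that belong to a block having a later element. The factor
    L^* at position k says that k is such an open position; the factor L^* T_beta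
    says that k is the largest element of a new block, with letters beta, whose
    other elements become open. The interleavings and the three cases in the
    definition of T say which positions may be opened without crossing the blocks
    that are already open. Hence the runs of the product that end in the vacuum
    are the bi-non-crossing partitions, each weighted by the product of its
    cumulants, and the sum of these weights is the moment.

    In detail, the nonzero coefficients of T_beta on basis tensors are all 1
    ([T_basis_coeff]): a word occurs exactly when it is a shuffle of the rest of
    beta with the old tensor in which, as long as both have letters left, the next
    letter is taken from beta if it lies on the side of the last letter of beta and
    from the tensor otherwise ([bishuffle]).

    The operators are homogeneous in the letters ([op_of_word_perm]), so only words
    beta over the annihilated letters, of bounded length, contribute to a vacuum
    expectation. This gives the finiteness ([bounded_well_defined]) and turns the
    formal moment into an iterate of honest operators ([omega_Zprod]).

    On the side of partitions, let [open_sum] k S be the weighted sum of the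
    bi-non-crossing partitions of the positions before k that are not in S, such
    that no block V separates an element of S from a point at the bottom of the
    diagram, after all positions considered. Removing the block of the last
    position k gives a recursion ([open_sum_block]), because V does not cross a
    block consisting of k and V' exactly when it separates no element of V'
    ([crossing_separated]). An induction on k ([foldr_Ztrunc]) shows that the
    first k factors, followed by the vacuum coefficient, send a tensor w to the
    sum of [open_sum] k S over the sets S that spell w. For k = n and w the
    vacuum, this is the moment-cumulant formula. *)

(** * Shuffles driven by the colours of their letters *)

Section BiShuffle.
Context (K : eqType).
Implicit Types (P : pred K) (u v s d : seq K) (x : K).

(** The words s produced by T: u is what remains of the new block, v is the old
    tensor, and P is the side of the last letter of the block. *)
Fixpoint bishuffle P u v s : bool :=
  if s is x :: s' then
    if P x then
      if u is y :: u' then (y == x) && bishuffle P u' v s' else v == s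
    else
      if v is y :: v' then (y == x) && bishuffle P u v' s' else u == s
  else (u == [::]) && (v == [::]).

Lemma bishuffle_sym P u v s : bishuffle P u v s = bishuffle (predC P) v u s.
Proof.
elim: s u v => [|x s IH] u v /=; first by rewrite andbC.
by case: (P x) => /=; [case: u => // y u | case: v => // y v]; rewrite IH.
Qed.

Lemma bishuffle0r P u s : bishuffle P u [::] s = (u == s).
Proof.
elim: s u => [|x s IH] [|y u] //=; case: (P x) => //.
by rewrite IH.
Qed.

Lemma bishuffle0l P v s : bishuffle P [::] v s = (v == s).
Proof. by rewrite bishuffle_sym bishuffle0r. Qed.

Lemma bishuffle_perm P u v s : bishuffle P u v s -> perm_eq s (u ++ v).
Proof.
elim: s u v => [|x s IH] u v /=; first by case/andP => /eqP-> /eqP->.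
case: (P x); [case: u => [|y u] | case: v => [|y v]].
- by move/eqP->.
- by case/andP => /eqP-> /IH; rewrite /= perm_cons.
- by move/eqP->; rewrite cats0.
- case/andP => /eqP-> /IH; rewrite -(perm_cons x) => /perm_trans; apply.
  exact: permEl (perm_catCA [:: x] u v).
Qed.

(** The first letter of u outside P can only be placed after v is exhausted, and
    the first letter of v in P only after u is exhausted. This is the case in which
    T vanishes. *)
Lemma bishuffle_has P u v s :
  has (predC P) u -> has P v -> bishuffle P u v s = false.
Proof.
elim: s u v => [|x s IH] u v hu hv /=; first by case: u hu.
case: ifPn => Px; [case: u hu => // y u | case: v hv => // y v] => /= h.
all: apply/negP => /andP[/eqP e]; move: h; rewrite e /= ?Px ?(negPf Px) /= => h.
all: by rewrite IH.
Qed.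

(** A letter of u outside P blocks u until v is exhausted; from then on the rest of
    u follows unchanged. *)
Lemma bishuffle_suffix P u v s :
  bishuffle P u v s -> suffix (drop (find (predC P) u) u) s.
Proof.
elim: s u v => [|x s IH] u v /=; first by case/andP => /eqP->.
case: ifPn => Px; [case: u => [|y u] | case: v => [|y v]] => //.
- by rewrite suffix0s.
- case/andP => /eqP-> /IH; rewrite /= Px /= => h.
  exact: suffix_trans h (suffix_cons _ _).
- by move/eqP->; rewrite /= Px /= suffix_refl.
- by case/andP => _ /IH h; exact: suffix_trans h (suffix_cons _ _).
Qed.

(** If v has no letter in P, the part of s before the blocked tail of u is a shuffle
    of two words of different colours, which the colours determine. *)
Lemma bishuffle_cat P u v s (k := find (predC P) u) :
  all (predC P) v ->
  bishuffle P u v (s ++ drop k u) =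
  ([seq x <- s | P x] == take k u) && ([seq x <- s | ~~ P x] == v).
Proof.
rewrite /k {k}; elim: s u v => [|x s IH] u v av /=.
  apply/idP/andP => [/bishuffle_perm/perm_size|[/eqP e /eqP <-]].
    rewrite size_cat size_drop.
    move: (find_size (predC P) u) => ku e; split; last first.
      by case: v e {av} => //=; lia.
    have k0 : find (predC P) u = 0%N by lia.
    by rewrite k0 take0.
  by rewrite bishuffle0r -{1}[u](cat_take_drop (find (predC P) u)) -e.
case: ifPn => Px /=.
  case: u => [|y u] /=.
    by case: v av => [|y v] //= /andP[Py _]; apply/eqP => -[e]; rewrite e Px in Py.
  case: ifPn => /= Py.
    apply/negbTE/negP => /andP[/eqP e].
    by rewrite e Px in Py.
  by rewrite eqseq_cons IH // andbA [x == y]eq_sym.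
case: v av => [|y v] /=.
  move=> _; rewrite andbF; apply/negbTE/negP => /eqP e.
  have /(congr1 size) := e; rewrite [in find _ _]e /= Px /= size_cat size_drop.
  by have := find_size (predC P) u; lia.
by case/andP => Py av; rewrite IH // eqseq_cons [x == y]eq_sym andbCA.
Qed.

End BiShuffle.

(** * Coefficients of Sigma and of the operators T *)

Section Interleaving.
Context (K : choiceType) (n a : nat).
Implicit Types (sigma : 'S_n) (s : seq K).

Definition perm_line sigma : seq nat := [seq val (sigma t) | t <- enum 'I_n].

Lemma perm_line_inj : injective perm_line.
Proof.
move=> s1 s2 /eq_in_map e; apply/permP => t; apply: val_inj.
by apply: e; rewrite mem_enum.
Qed.

Lemma mem_perm_line sigma i : (i \in perm_line sigma) = (i < n)%N.
Proof.
apply/mapP/idP => [[t _ ->]|ilt]; first exact: ltn_ord.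
by exists ((sigma^-1)%g (Ordinal ilt)); rewrite ?mem_enum // permKV.
Qed.

Lemma pairwise_enum_ord : pairwise (fun s t : 'I_n => s < t)%N (enum 'I_n).
Proof.
have := iota_ltn_sorted 0 n; rewrite (sorted_pairwise ltn_trans) -val_enum_ord.
by rewrite pairwise_map.
Qed.

(** Both halves of an interleaving are increasing, hence equal to the increasing list
    of their elements; C selects one of the halves. *)
Lemma interleaves_filter sigma (C : pred nat) (m l : nat) : interleaves a sigma ->
  (forall i, C i && (i < n)%N = (m <= i < m + l)%N) ->
  (forall i j, (i < j)%N -> (C i && C j) -> (j < a)%N || (a <= i)%N) ->
  [seq i <- perm_line sigma | C i] = iota m l.
Proof.
move=> /forallP si Cn Ca; apply: (irr_sorted_eq ltn_trans ltnn).
- rewrite (sorted_pairwise ltn_trans).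
  apply: (@sub_in_pairwise _ C (fun i j => C i && C j ==> (i < j)%N)).
  + by move=> i j Ci Cj /=; rewrite (Ci : C i = true) (Cj : C j = true).
  + exact: filter_all.
  apply: pairwise_filter; rewrite pairwise_map.
  apply: sub_pairwise pairwise_enum_ord => s t /= st; apply/implyP => /andP[Cs Ct].
  case: (ltngtP (sigma s) (sigma t)) => // [ts|/val_inj/perm_inj e]; last first.
    by move: st; rewrite e ltnn.
  have /forallP/(_ s)/implyP := si t.
  rewrite ts Ca ?Ct // => /(_ isT) ts'.
  by move: (ltn_trans st ts'); rewrite ltnn.
- exact: iota_ltn_sorted.
by move=> i; rewrite mem_filter mem_perm_line mem_iota Cn.
Qed.

End Interleaving.

Lemma eq_by_filter (T U : eqType) (f : T -> U) (C : pred T) (D : pred U) (s t : seq T) :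
  (forall x, x \in s -> C x = D (f x)) -> (forall x, x \in t -> C x = D (f x)) ->
  map f s = map f t -> filter C s = filter C t ->
  filter (predC C) s = filter (predC C) t -> s = t.
Proof.
elim: s t => [|x s IH] [|y t] //= Cs Ct [fxy] e.
have Cxy : C x = C y by rewrite Cs ?mem_head // Ct ?mem_head // fxy.
have {}Cs z : z \in s -> C z = D (f z) by move=> zs; rewrite Cs // in_cons zs orbT.
have {}Ct z : z \in t -> C z = D (f z) by move=> zs; rewrite Ct // in_cons zs orbT.
rewrite Cxy; case: (C y) => /=; first by case=> <- e1 e2; rewrite (IH t).
by move=> e1 [<- e2]; rewrite (IH t).
Qed.

Lemma eqseq_cat2r (T : eqType) (d s t : seq T) : (s ++ d == t ++ d) = (s == t).
Proof.
have rI := can_inj (@revK T).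
by rewrite -(inj_eq rI) !rev_cat eqseq_cat // eqxx (inj_eq rI).
Qed.

Section SigmaCoefficient.
Context (R : realType) (I J : choiceType).
Local Notation K := (I + J)%type.
Implicit Types (P : pred K) (u v s : seq K).

Definition perm_word s (sigma : 'S_(size s)) : seq K :=
  [seq tnth (in_tuple s) (sigma t) | t <- enum 'I_(size s)].

Lemma perm_wordE x0 s (sigma : 'S_(size s)) :
  perm_word sigma = map (nth x0 s) (perm_line sigma).
Proof.
by rewrite -map_comp; apply: eq_map => t; rewrite /= (tnth_nth x0).
Qed.

Lemma map_nth_catl x0 u v : map (nth x0 (u ++ v)) (iota 0 (size u)) = u.
Proof.
apply: (@eq_from_nth _ x0) => [|i]; rewrite size_map size_iota // => iu.
by rewrite (nth_map 0%N) ?size_iota // nth_iota // add0n nth_cat iu.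
Qed.

Lemma map_nth_catr x0 u v : map (nth x0 (u ++ v)) (iota (size u) (size v)) = v.
Proof.
apply: (@eq_from_nth _ x0) => [|i]; rewrite size_map size_iota // => iu.
rewrite (nth_map 0%N) ?size_iota // nth_iota // nth_cat ltnNge leq_addr /=.
by rewrite addKn.
Qed.

Section TwoColours.
Context (P : pred K) (u v : seq K).
Context (Pu : all P u) (Pv : all (predC P) v).
Local Notation n := (size (u ++ v)).

Lemma P_nth x0 i : (i < n)%N -> P (nth x0 (u ++ v) i) = (i < size u)%N.
Proof.
rewrite size_cat nth_cat => ilt; case: ltnP => iu; first by rewrite (all_nthP x0 Pu).
by apply/negbTE; apply: (all_nthP x0 Pv); lia.
Qed.

Section Line.
Context (sigma : 'S_n) (si : interleaves (size u) sigma).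

Lemma lineL : [seq i <- perm_line sigma | (i < size u)%N] = iota 0 (size u).
Proof. by apply: interleaves_filter si _ _ => i; rewrite ?size_cat; lia. Qed.

Lemma lineR : [seq i <- perm_line sigma | ~~ (i < size u)%N] = iota (size u) (size v).
Proof. by apply: interleaves_filter si _ _ => i; rewrite ?size_cat; lia. Qed.

Lemma perm_word_filterL : [seq x <- perm_word sigma | P x] = u.
Proof.
case: (posnP n) => [n0|n_gt0].
  transitivity (@nil K); last by apply/esym/nilP; move: n0; rewrite size_cat /nilp; lia.
  apply/nilP; rewrite /nilp size_filter -leqn0 (leq_trans (count_size _ _)) //.
  by rewrite size_map size_enum_ord n0.
have x0 := tnth (in_tuple (u ++ v)) (Ordinal n_gt0).
rewrite (perm_wordE x0) filter_map -[RHS](map_nth_catl x0 u v); congr map.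
rewrite -lineL; apply: eq_in_filter => i; rewrite mem_perm_line => ilt /=.
exact: P_nth.
Qed.

Lemma perm_word_filterR : [seq x <- perm_word sigma | ~~ P x] = v.
Proof.
case: (posnP n) => [n0|n_gt0].
  transitivity (@nil K); last by apply/esym/nilP; move: n0; rewrite size_cat /nilp; lia.
  apply/nilP; rewrite /nilp size_filter -leqn0 (leq_trans (count_size _ _)) //.
  by rewrite size_map size_enum_ord n0.
have x0 := tnth (in_tuple (u ++ v)) (Ordinal n_gt0).
rewrite (perm_wordE x0) filter_map -[RHS](map_nth_catr x0 u v); congr map.
rewrite -lineR; apply: eq_in_filter => i; rewrite mem_perm_line => ilt /=.
by rewrite P_nth.
Qed.

End Line.

Lemma perm_word_inj (s1 s2 : 'S_n) :
  interleaves (size u) s1 -> interleaves (size u) s2 ->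
  perm_word s1 = perm_word s2 -> s1 = s2.
Proof.
move=> i1 i2 e; apply: perm_line_inj; case: (posnP n) => [n0|n_gt0].
  have N (s : 'S_n) : perm_line s = [::].
    by apply/nilP; rewrite /nilp size_map size_enum_ord n0.
  by rewrite !N.
have x0 := tnth (in_tuple (u ++ v)) (Ordinal n_gt0).
move: e; rewrite !(perm_wordE x0).
have C (s : 'S_n) i : i \in perm_line s -> (i < size u)%N = P (nth x0 (u ++ v) i).
  by rewrite mem_perm_line => ilt; rewrite P_nth.
move=> e; apply: (eq_by_filter (C _) (C _) e); first by rewrite !lineL.
exact: etrans (lineR i1) (esym (lineR i2)).
Qed.

Lemma perm_word_exists s :
  [seq x <- s | P x] = u -> [seq x <- s | ~~ P x] = v ->
  exists2 sigma : 'S_n, interleaves (size u) sigma & perm_word sigma = s.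
Proof.
move=> su sv.
have cu : count P s = size u by rewrite -size_filter su.
have cv : count (predC P) s = size v by rewrite -size_filter sv.
have ns : n = size s by rewrite size_cat -cu -cv count_predC.
case: s su sv cu cv ns => [|x0 s'].
  move=> /= <- /= <- _ _ _; exists 1%g; first by apply/forallP; case.
  by apply/nilP; rewrite /nilp size_map size_enum_ord.
set s := x0 :: s' => su sv cu cv ns.
have cS (C : pred K) t : (t < size s)%N ->
    count C (take t.+1 s) = (count C (take t s) + C (nth x0 s t))%N.
  by move=> ts; rewrite (take_nth x0) // -cats1 count_cat /= addn0.
have cm (C : pred K) t t' : (t <= t')%N -> (count C (take t s) <= count C (take t' s))%N.
  by move=> tt'; rewrite -(subnKC tt') takeD count_cat leq_addr.
have cl (C : pred K) t : (t < size s)%N -> C (nth x0 s t) ->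
    (count C (take t s) < count C s)%N.
  move=> ts Ct; apply: (@leq_trans (count C (take t.+1 s))); first by rewrite cS // Ct addn1.
  by rewrite -[X in (_ <= count C X)%N](cat_take_drop t.+1 s) count_cat leq_addr.
(* A letter goes to its rank among the letters of its colour, those of v being
   placed after those of u. *)
pose f (t : nat) := if P (nth x0 s t) then count P (take t s)
                    else (size u + count (predC P) (take t s))%N.
have fu t : (t < n)%N -> (f t < size u)%N = P (nth x0 s t).
  by rewrite ns /f => ts; case: ifPn => Pt; rewrite -?cu ?cl //; lia.
have fn (t : 'I_n) : (f t < n)%N.
  rewrite [X in (_ < X)%N]size_cat /f; have := ltn_ord t; rewrite [X in (_ < X)%N -> _]ns => ts.
  case: ifPn => Pt; first by have := cl P t ts Pt; lia.
  by have := cl (predC P) t ts Pt; lia.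
have flt t t' : (t < t')%N -> (t' < n)%N -> P (nth x0 s t) = P (nth x0 s t') ->
    (f t < f t')%N.
  rewrite ns => tt' ts' e; have ts := ltn_trans tt' ts'; rewrite /f -e.
  case: ifPn => Pt.
    by have := cm P _ _ tt'; rewrite cS // Pt; lia.
  by have := cm (predC P) _ _ tt'; rewrite cS //= Pt; lia.
have finj : injective (fun t => Ordinal (fn t)).
  move=> t t' /(congr1 val) /= e; apply: val_inj => /=.
  have eP : P (nth x0 s t) = P (nth x0 s t') by rewrite -!fu // e.
  case: (ltngtP t t') => // tt'; have := flt _ _ tt' (ltn_ord _).
    by rewrite eP e ltnn => /(_ erefl).
  by rewrite eP e ltnn => /(_ erefl).
exists (perm finj).
  apply/forallP => t; apply/forallP => t'; rewrite !permE /=.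
  apply/implyP => /andP[ff h].
  have eP : P (nth x0 s t) = P (nth x0 s t') by rewrite -!fu //; lia.
  case: (ltngtP t t') => // [tt'|e]; last by rewrite e ltnn in ff.
  by have := flt _ _ tt' (ltn_ord _) (esym eP); lia.
rewrite (perm_wordE x0); apply: (@eq_from_nth _ x0) => [|t].
  by rewrite size_map [size _]size_map size_enum_ord.
rewrite size_map [size _]size_map size_enum_ord => tn.
rewrite -map_comp (nth_map (Ordinal tn)) ?size_enum_ord //= permE /=.
rewrite nth_enum_ord // nth_cat fu // /f.
have ts : (t < size s)%N by rewrite -ns.
have nf (C : pred K) : C (nth x0 s t) -> nth x0 (filter C s) (count C (take t s)) = nth x0 s t.
  move=> Ct; rewrite -[in filter _ _](cat_take_drop t s) filter_cat nth_cat size_filter ltnn.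
  by rewrite subnn (drop_nth x0 ts) /= Ct.
case: (boolP (P (nth x0 s t))) => Pt; first by have := nf P Pt; rewrite su.
by have := nf (predC P) Pt; rewrite sv addKn.
Qed.

(** The colour of a letter tells which of the two words it comes from, so a word
    arises from at most one interleaving and no multiplicities occur. *)
Lemma Sigma_coeff s :
  (Sigma R u v)@_s = (([seq x <- s | P x] == u) && ([seq x <- s | ~~ P x] == v))%:R.
Proof.
rewrite raddf_sum /=.
rewrite (eq_bigr (fun sigma => (perm_word sigma == s)%:R)); last first.
  by move=> sigma _; rewrite mcoeffU.
case: (boolP (_ && _)) => [/andP[/eqP su /eqP sv]|h].
  have [s0 i0 w0] := perm_word_exists su sv.
  rewrite (bigD1 s0) //= w0 eqxx big1 ?addr0 // => s1 /andP[i1 ne].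
  case: eqP => // w1; case/eqP: ne; apply: perm_word_inj => //.
  by rewrite w0 w1.
apply: big1 => s1 i1; case: eqP => // w1; case/negP: h.
by rewrite -w1 perm_word_filterL // perm_word_filterR // !eqxx.
Qed.

End TwoColours.

Lemma tens_etensr_cat (y : fock R K) u d : (tens y (etens R d))@_(u ++ d) = y@_u.
Proof.
rewrite linext_coeff (eq_bigr (fun w => y@_w * (w == u)%:R)); last first.
  move=> w _; congr (_ * _); rewrite /linext /etens msuppU oner_eq0.
  by rewrite big_seq_fset1 mcoeffUU scale1r mcoeffU eqseq_cat2r.
case: (boolP (u \in msupp y)) => yu; last first.
  rewrite mcoeff_outdom // big1_seq // => w /= wy.
  by case: eqP => [e|]; [rewrite -e wy in yu | rewrite mulr0].
rewrite (big_fsetD1 u) //= eqxx mulr1 big1_seq ?addr0 // => w /=.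
by rewrite in_fsetD1 => /andP[/negPf-> _]; rewrite mulr0.
Qed.

Lemma tens_etensr_suffix (y : fock R K) d s : ~~ suffix d s -> (tens y (etens R d))@_s = 0.
Proof.
move=> ns; rewrite linext_coeff big1 // => w _; rewrite /linext /etens msuppU oner_eq0.
rewrite big_seq_fset1 mcoeffUU scale1r mcoeffU.
by case: eqP => [e|]; [rewrite -e suffix_suffix in ns | rewrite mulr0].
Qed.

Definition same_side (a k : K) := side k == side a.

Lemma all_take_find P u : all P (take (find (predC P) u) u).
Proof. by rewrite -[all _ _]negbK -has_predC has_take_leq ?find_size // ltnn. Qed.

(** The common shape of the two nonzero cases of T on a nonempty tensor: u is the
    new block and v the old tensor in one of them, the converse in the other. *)
Lemma shuffle_tail_coeff P a u v s (X : fock R K) (k := find (predC P) u) :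
  all (predC P) v ->
  (forall t, X@_t =
     (([seq x <- t | P x] == take k u) && ([seq x <- t | ~~ P x] == v))%:R) ->
  (tens (creation a X) (etens R (drop k u)))@_s =
  (if s is b :: t then (b == a) && bishuffle P u v t else false)%:R.
Proof.
move=> Pv hX; case: (boolP (suffix (drop k u) s)) => [/suffixP[s1 e]|ns]; last first.
  rewrite tens_etensr_suffix //; case: s ns => [|b t] // ns.
  case: andP => // -[_ /bishuffle_suffix h].
  by case/negP: ns; exact: suffix_trans h (suffix_cons _ _).
rewrite e tens_etensr_cat creation_coeff; case: s1 e => [|b s1] e /=.
  case E: (drop k u) => [|b t] //; case: andP => // -[_ /bishuffle_suffix].
  by move/size_suffix; rewrite -/k E /= ltnn.
rewrite bishuffle_cat // hX; by case: (b == a).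
Qed.

(** One formula for all the cases in the definition of T; the two shuffling cases
    are exchanged by [bishuffle_sym]. *)
Lemma T_basis_coeff alpha a ra eta s : rev alpha = a :: ra ->
  (T_basis R alpha eta)@_s =
  (if s is b :: t then (b == a) && bishuffle (same_side a) ra eta t else false)%:R.
Proof.
move=> ralpha; rewrite /T_basis ralpha.
case: eqP => [->|/eqP eta0].
  rewrite mcoeffU; case: s => [|b t] //.
  by rewrite bishuffle0r eqseq_cons eq_sym.
case: eqP => [sz|_].
  have : size (rev alpha) = 1%N by rewrite size_rev.
  rewrite ralpha => -[] /eqP/nilP ->.
  rewrite creation_coeff; case: s => [|b t] //.
  rewrite bishuffle0l mcoeffU; by case: (b == a).
case: ifPn => [opp|].
  have Peta : all (predC (same_side a)) eta by rewrite all_predC.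
  apply: (@shuffle_tail_coeff (same_side a)) => // t.
  by rewrite (Sigma_coeff (all_take_find _ _) Peta).
rewrite negbK => hs; case: ifPn => ho.
  rewrite mcoeff0; case: s => [|b t] //; rewrite bishuffle_has ?andbF //.
  by move: ho; rewrite -has_rev ralpha /= eqxx.
have Pra : all (same_side a) ra.
  move: ho; rewrite -has_rev ralpha /= eqxx /= -all_predC => h.
  by apply: sub_all h => x /=; rewrite negbK.
have Pra' : all (predC (predC (same_side a))) ra.
  by apply: sub_all Pra => x /=; rewrite negbK.
rewrite (eq_find (a2 := predC (predC (same_side a)))); last first.
  by move=> x /=; rewrite negbK.
rewrite (shuffle_tail_coeff a s (P := predC (same_side a)) (v := ra)) //.
  by case: s => [|b t] //; rewrite [in RHS]bishuffle_sym.
move=> t; rewrite (Sigma_coeff Pra (all_take_find _ _)) andbC.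
by congr (_ && (_ == _))%:R; apply: eq_filter => x; rewrite /= negbK.
Qed.

End SigmaCoefficient.

(** * Homogeneity and finiteness *)

Section Words.
Context (T : eqType).

Fixpoint words_upto (L : seq T) (N : nat) : seq (seq T) :=
  if N is N'.+1 then [::] :: [seq x :: w | x <- L, w <- words_upto L N'] else [:: [::]].

Lemma mem_words_upto L N w : (size w <= N)%N -> {subset w <= L} -> w \in words_upto L N.
Proof.
elim: N w => [|N IH] [|x w] //= wN wL; rewrite ?mem_head // in_cons /=.
apply: allpairs_f; first by apply: wL; rewrite mem_head.
by apply: IH => // y yw; apply: wL; rewrite in_cons yw orbT.
Qed.

End Words.

Section FockLinear.
Context (R : realType) (K : choiceType).
Local Notation fock := (fock R K).

Lemma linext_is_linear (f : seq K -> fock) : linear (linext f).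
Proof.
move=> c x y; pose d := (msupp x `|` msupp y)%fset.
have dx : {subset msupp x <= d} by move=> w wx; rewrite in_fsetU wx.
have dy : {subset msupp y <= d} by move=> w wy; rewrite in_fsetU wy orbT.
have dxy : {subset msupp (c *: x + y) <= d}.
  move=> w; rewrite in_fsetU; apply: contraLR; rewrite negb_or => /andP[wx wy].
  by rewrite -mcoeff_eq0 mcoeffD mcoeffZ !mcoeff_outdom ?mulr0 ?addr0.
rewrite (linext_supp f dx) (linext_supp f dy) (linext_supp f dxy).
rewrite scaler_sumr -big_split; apply: eq_bigr => w _.
by rewrite mcoeffD mcoeffZ scalerDl scalerA.
Qed.

HB.instance Definition _ (f : seq K -> fock) :=
  GRing.isLinear.Build R[i] fock fock *:%R (linext f) (linext_is_linear f).

HB.instance Definition _ (k : K) :=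
  GRing.isLinear.Build R[i] fock fock *:%R (@annihilation R K k) (linext_is_linear _).

Lemma linext_neq0 (f : seq K -> fock) (x : fock) s :
  (linext f x)@_s != 0 -> exists2 w, x@_w != 0 & (f w)@_s != 0.
Proof.
rewrite linext_coeff => h; apply: contrapT => no; case/eqP: h.
apply: big1 => w _; case: (eqVneq x@_w 0) => [->|xw]; first by rewrite mul0r.
case: (eqVneq (f w)@_s 0) => [->|fw]; first by rewrite mulr0.
by case: no; exists w.
Qed.

Lemma inner_vacuum (x : fock) : inner x (vacuum R K) = x@_[::].
Proof.
rewrite /inner /vacuum /etens.
rewrite (eq_bigr (fun w => if w == [::] then x@_w else 0)); last first.
  move=> w _; rewrite mcoeffU eq_sym.
  by case: (w == [::]); rewrite ?conjC1 ?conjC0 ?mulr1 ?mulr0.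
case: (boolP ([::] \in msupp x)) => x0; last first.
  rewrite mcoeff_outdom // big1_seq // => w /= wx.
  by case: eqP => // e; rewrite -e wx in x0.
rewrite (big_fsetD1 [::]) //= big1_seq ?addr0 // => w /=.
by rewrite in_fsetD1 => /andP[/negPf-> _].
Qed.

End FockLinear.

Section Content.
Context (R : realType) (I J : choiceType).
Local Notation K := (I + J)%type.
Local Notation fock := (fock R K).
Implicit Types (u v : seq (opsym I J)).

HB.instance Definition _ (alpha : seq K) :=
  GRing.isLinear.Build R[i] fock fock *:%R (@T_op R I J alpha) (linext_is_linear _).

Definition annihilated u : seq K :=
  flatten [seq if o is inl k then [:: k] else [::] | o <- u].
Definition created u : seq K :=
  flatten [seq if o is inr alpha then alpha else [::] | o <- u].

Lemma T_basis_perm (alpha w s : seq K) : (T_basis R alpha w)@_s != 0 -> perm_eq s (alpha ++ w).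
Proof.
case e: (rev alpha) => [|a ra]; first by rewrite /T_basis e mcoeff0 eqxx.
rewrite (T_basis_coeff _ _ _ e); case: s => [|b s]; rewrite ?eqxx //.
case: andP => [[/eqP-> /bishuffle_perm h] _|]; last by rewrite eqxx.
rewrite (@perm_trans _ (rev alpha ++ w)) //; last by rewrite perm_cat2r perm_rev.
by rewrite e /= perm_cons.
Qed.

(** T_alpha adds the letters of alpha to a tensor and L_k^* removes one letter k. *)
Lemma op_of_word_perm u (x : fock) s : (op_of_word u x)@_s != 0 ->
  exists2 w, x@_w != 0 & perm_eq (s ++ annihilated u) (created u ++ w).
Proof.
elim: u s => [|[k|alpha] u IH] s /=; first by exists s; rewrite // cats0.
  rewrite annihilation_coeff => /IH[w xw p]; exists w => //.
  apply: perm_trans p; rewrite /annihilated /= -cat_cons -/(annihilated u).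
  by rewrite -cat_rcons perm_cat2r perm_rcons.
case/linext_neq0 => s' /IH[w xw p] /T_basis_perm p'; exists w => //.
rewrite /created /annihilated /= -/(created u) -/(annihilated u) -catA.
apply: perm_trans (_ : perm_eq _ ((alpha ++ s') ++ annihilated u)) _.
  by rewrite perm_cat2r.
by rewrite -catA perm_cat2l.
Qed.

(** A condition on formal sums that passes to products, unlike the finiteness of
    the vacuum terms. Bounding the annihilations is enough: in a nonzero vacuum
    term, homogeneity then bounds the creations. *)
Definition bounded (F : fsum R I J) : Prop := exists (L : seq K) (N : nat),
  forall u, F u != 0 ->
    [/\ {subset annihilated u <= L}, (size (annihilated u) <= N)%N & inr [::] \notin u].

Lemma annihilated_cat u v : annihilated (u ++ v) = annihilated u ++ annihilated v.
Proof. by rewrite /annihilated map_cat flatten_cat. Qed.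

Lemma vacuum_term_perm (F : fsum R I J) u :
  vacuum_term F u != 0 -> F u != 0 /\ perm_eq (annihilated u) (created u).
Proof.
rewrite /vacuum_term inner_vacuum mulf_eq0 negb_or => /andP[Fu /op_of_word_perm[w w0 p]].
split=> //; move: w0 p; rewrite mcoeffU; case: ([::] =P w) => [<- _|_]; last by rewrite mulr0n eqxx.
by rewrite cats0.
Qed.

Lemma mem_created u (alpha : seq K) : inr alpha \in u -> {subset alpha <= created u}.
Proof.
by move=> ua k ka; apply/flattenP; exists alpha => //; apply/mapP; exists (inr alpha).
Qed.

Lemma size_created u (alpha : seq K) : inr alpha \in u -> (size alpha <= size (created u))%N.
Proof.
move=> ua; rewrite size_flatten /shape -map_comp.
elim: u ua => //= o u IH; rewrite in_cons => /predU1P[<-|/IH]; lia.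
Qed.

Lemma size_opword u : inr [::] \notin u ->
  (size u <= size (annihilated u) + size (created u))%N.
Proof.
elim: u => //= o u IH; rewrite in_cons negb_or => /andP[o0 /IH].
rewrite /annihilated /created /= !size_cat -/(annihilated u) -/(created u).
by case: o o0 => [k|[|b alpha]] //=; lia.
Qed.

(** The symbols of a word with nonzero vacuum term range over a finite set, and the
    length is bounded since every T_alpha creates at least one letter. *)
Lemma bounded_well_defined F : bounded F -> vacuum_well_defined F.
Proof.
move=> [L [N FLN]].
pose S : seq (opsym I J) := map inl L ++ map inr (words_upto L N).
apply: (@sub_finite_set _ _ [set` words_upto S (N + N)]%classic); last exact: finite_seq.
move=> u /= /vacuum_term_perm[/FLN[uL uN u0] p]; apply: mem_words_upto.
  apply: leq_trans (size_opword u0) _.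
  by rewrite -(perm_size p) leq_add.
move=> [k|alpha] ou; rewrite mem_cat.
  rewrite map_f // uL //; apply/flattenP; exists [:: k]; last by rewrite mem_head.
  by apply/mapP; exists (inl k).
rewrite orbC map_f //; apply: mem_words_upto.
  by apply: leq_trans uN; rewrite (perm_size p) size_created.
by move=> k ka; apply: uL; rewrite (perm_mem p); apply: mem_created ou _ ka.
Qed.

Lemma fsum_mul_neq0 (F G : fsum R I J) u : fsum_mul F G u != 0 ->
  exists u1 u2, [/\ u = u1 ++ u2, F u1 != 0 & G u2 != 0].
Proof.
move=> h; apply: contrapT => no; case/eqP: h; apply: big1 => i _.
case: (eqVneq (F (take i u)) 0) => [->|Fi]; first by rewrite mul0r.
case: (eqVneq (G (drop i u)) 0) => [->|Gi]; first by rewrite mulr0.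
by case: no; exists (take i u), (drop i u); rewrite cat_take_drop.
Qed.

Lemma bounded_mul (F G : fsum R I J) : bounded F -> bounded G -> bounded (fsum_mul F G).
Proof.
move=> [L [N FL]] [M [P GM]]; exists (L ++ M), (N + P)%N.
move=> _ /fsum_mul_neq0[u [v [-> /FL[uL uN u0] /GM[vM vP v0]]]].
rewrite annihilated_cat size_cat leq_add // mem_cat negb_or u0 v0; split=> // k.
by rewrite !mem_cat => /orP[/uL->|/vM->]; rewrite ?orbT.
Qed.

Section Generators.
Context (A : algType R[i]) (kappa : functionals A) (z : K -> A).

Lemma bounded_Z k : bounded (Z kappa z k).
Proof.
apply: bounded_mul.
  exists [:: k], 1%N => u; rewrite /fsum_sym.
  case: (u =P [:: inl k]) => [->|]; last by rewrite eqxx.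
  by move=> _; split.
exists [::], 0%N => -[_|[j|alpha] [|o u]]; rewrite /Theta ?eqxx //=.
case: ifPn => [_|a0 _]; rewrite ?eqxx //; split=> //.
by rewrite mem_seq1; apply/eqP => -[e]; rewrite -e eqxx in a0.
Qed.

Lemma fsum_alg_bounded F : fsum_alg (Z kappa z) F -> bounded F.
Proof.
elim=> {F} [|k|F G _ [L [N FL]] _ [M [P GM]]|c F _ [L [N FL]]|F G _ ? _ ?].
- exists [::], 0%N => u; rewrite /fsum1; case: (u =P [::]) => [->|]; last by rewrite eqxx.
  by move=> _; split.
- exact: bounded_Z.
- exists (L ++ M), (maxn N P) => u FGu.
  have [Fu|Gu] : F u != 0 \/ G u != 0.
  + apply/orP; rewrite -negb_and; apply: contra FGu => /andP[/eqP Fu /eqP Gu].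
    by rewrite -[(F + G) u]/(F u + G u) Fu Gu addr0.
  + have [uL uN u0] := FL u Fu; split=> //; last by rewrite leq_max uN.
    by move=> k /uL; rewrite mem_cat => ->.
  have [uL uN u0] := GM u Gu; split=> //; last by rewrite leq_max uN orbT.
  by move=> k /uL; rewrite mem_cat => ->; rewrite orbT.
- exists L, N => u; rewrite -[(c *: F) u]/(c * F u) mulf_eq0 negb_or => /andP[_].
  exact: FL.
- exact: bounded_mul.
Qed.

End Generators.

End Content.

(** * Moments as iterated operators *)

Lemma linear_scale_sum (R : nzRingType) (V : lmodType R) (f g : {linear V -> V})
    (T : Type) (r : seq T) (c : R) (F : T -> R) (G : T -> V) :
  f (c *: g (\sum_(u <- r) F u *: G u)) = \sum_(u <- r) (c * F u) *: f (g (G u)).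
Proof.
rewrite linearZ !linear_sum /= scaler_sumr; apply: eq_bigr => u _.
by rewrite !linearZ /= scalerA.
Qed.

Section Products.
Context (R : realType) (I J : choiceType) (A : algType R[i]).
Context (kappa : functionals A) (z : I + J -> A).
Local Notation K := (I + J)%type.
Local Notation fock := (fock R K).
Implicit Types (u v : seq (opsym I J)) (s : seq K).

Definition Zprod s : fsum R I J := foldr (fun k F => fsum_mul (Z kappa z k) F) (@fsum1 R I J) s.

Lemma fsum_mul_sym (o : opsym I J) (F : fsum R I J) u :
  fsum_mul (@fsum_sym R I J o) F u = if u is o' :: v then (o' == o)%:R * F v else 0.
Proof.
rewrite /fsum_mul /fsum_sym; case: u => [|o' u].
  by rewrite big_ord_recl big_ord0 /= mul0r addr0.
rewrite big_ord_recl mul0r add0r big_ord_recl /= take0 drop0 eqseq_cons eqxx andbT.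
rewrite big1 ?addr0 // => i _; case: u i => [|o2 u] i; first by case: i.
by rewrite /= eqseq_cons andbF mul0r.
Qed.

Lemma fsum_mul_Theta (F : fsum R I J) u :
  fsum_mul (Theta kappa z) F u =
  F u + (if u is inr alpha :: v then
           if alpha == [::] then 0 else kappa_word kappa z alpha * F v else 0).
Proof.
rewrite /fsum_mul; case: u => [|o u].
  by rewrite big_ord_recl big_ord0 /= mul1r.
rewrite big_ord_recl mul1r drop0; congr (_ + _).
rewrite big_ord_recl /= take0 drop0 big1 ?addr0 => [|i _].
  by case: o => [k|alpha]; rewrite ?mul0r //; case: ifP; rewrite ?mul0r.
case: u i => [|o2 u] i; first by case: i.
by case: o => ? /=; rewrite mul0r.
Qed.

Lemma fsum_mulA_sym (o : opsym I J) (F G : fsum R I J) u :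
  fsum_mul (fsum_mul (@fsum_sym R I J o) F) G u = fsum_mul (@fsum_sym R I J o) (fsum_mul F G) u.
Proof.
rewrite fsum_mul_sym {1}/fsum_mul; case: u => [|o' u].
  by rewrite big_ord_recl big_ord0 /= fsum_mul_sym mul0r addr0.
rewrite big_ord_recl fsum_mul_sym mul0r add0r mulr_sumr; apply: eq_bigr => i _.
by rewrite fsum_mul_sym /= mulrA.
Qed.

Lemma Zprod_cons k s u :
  Zprod (k :: s) u =
  if u is o :: v then (o == inl k)%:R * fsum_mul (Theta kappa z) (Zprod s) v else 0.
Proof. by rewrite /= fsum_mulA_sym fsum_mul_sym. Qed.

(** Hence in a word of a product of Z's a symbol T_alpha belongs to the factor of the
    annihilation just before it, and the word determines the choices made. *)
Lemma Zprod_inr s (alpha : seq K) u : Zprod s (inr alpha :: u) = 0.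
Proof. by case: s => [|k s]; rewrite ?Zprod_cons // mul0r. Qed.

(** Z_k itself sends a tensor to an infinite sum; for a given moment a finite list B
    of words suffices. *)
Definition Ztrunc (B : seq (seq K)) k (x : fock) : fock :=
  annihilation k (x + \sum_(alpha <- B) kappa_word kappa z alpha *: T_op alpha x).

Fixpoint Z_choices (B : seq (seq K)) s : seq (seq (opsym I J)) :=
  if s is k :: s' then
    [seq inl k :: u | u <- Z_choices B s'] ++
    [seq inl k :: inr alpha :: u | alpha <- B, u <- Z_choices B s']
  else [:: [::]].

Lemma Z_choices_inr B s (alpha : seq K) u : inr alpha :: u \notin Z_choices B s.
Proof.
apply/negP; case: s => [|k s] //=.
by rewrite mem_cat => /orP[/mapP[? _]|/allpairsP[? [_ _]]].
Qed.

Lemma Z_choices_uniq B s : uniq B -> uniq (Z_choices B s).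
Proof.
move=> uB; elim: s => //= k s IH; rewrite cat_uniq map_inj_uniq ?IH; last by move=> u v [].
rewrite andTb allpairs_uniq //; last first.
  by move=> [a u] [b v] _ _ /= [-> ->].
rewrite andbT; apply/hasPn => w /allpairsP[[alpha u] /= [_ _ ->]].
apply/mapP => -[v vs [e]]; move: vs; rewrite -e; exact/negP/Z_choices_inr.
Qed.

Lemma Zprod_inl B k s u : u \in Z_choices B s -> Zprod (k :: s) (inl k :: u) = Zprod s u.
Proof.
rewrite Zprod_cons eqxx mul1r fsum_mul_Theta => us.
suff -> : (if u is inr alpha :: v then
    if alpha == [::] then 0 else kappa_word kappa z alpha * Zprod s v else 0) = 0.
  by rewrite addr0.
case: u us => [|[j|alpha] u] us; [reflexivity | reflexivity |].
by rewrite (negPf (Z_choices_inr B s alpha u)) in us.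
Qed.

Lemma Zprod_inl_inr k s (alpha : seq K) u : alpha != [::] ->
  Zprod (k :: s) (inl k :: inr alpha :: u) = kappa_word kappa z alpha * Zprod s u.
Proof.
by move=> /negPf a0; rewrite Zprod_cons eqxx mul1r fsum_mul_Theta Zprod_inr add0r a0.
Qed.

(** Distributing the product of the truncated operators. *)
Lemma Z_choices_big B s (x : fock) : all (predC1 [::]) B ->
  \sum_(u <- Z_choices B s) Zprod s u *: op_of_word u x = foldr (Ztrunc B) x s.
Proof.
move=> B0; elim: s => [|k s IH]; first by rewrite big_seq1 /= scale1r.
rewrite [foldr _ _ _]/= -IH /Ztrunc linearD !linear_sum [LHS]big_cat; congr (_ + _).
  rewrite big_map; apply: eq_big_seq => u us.
  by rewrite (Zprod_inl k us) [RHS]linearZ.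
rewrite big_allpairs_dep; apply: eq_big_seq => alpha aB.
have a0 : alpha != [::] := allP B0 _ aB.
pose f : {linear fock -> fock} := @annihilation R K k.
pose g : {linear fock -> fock} := @T_op R I J alpha.
apply: etrans (esym (linear_scale_sum f g _ _ _ _)).
by apply: eq_bigr => u _; rewrite (Zprod_inl_inr _ _ _ a0).
Qed.

Lemma Z_choices_mem (B : seq (seq K)) s u :
  Zprod s u != 0 -> (forall alpha : seq K, inr alpha \in u -> alpha != [::] -> alpha \in B) ->
  u \in Z_choices B s.
Proof.
elim: s u => [|k s IH] u; first by rewrite /= /fsum1; case: (u =P [::]) => [->|]; rewrite ?eqxx.
rewrite Zprod_cons; case: u => [|o u]; first by rewrite eqxx.
case: (o =P inl k) => [->|]; last by rewrite mul0r eqxx.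
rewrite mul1r fsum_mul_Theta /= mem_cat => h uB.
have tl (o' : opsym I J) v (alpha : seq K) : inr alpha \in v -> inr alpha \in o' :: v.
  by rewrite in_cons orbC => ->.
case: u h uB => [|[j|alpha] u] h uB.
- by rewrite map_f // IH //; rewrite addr0 in h.
- by rewrite map_f // IH //; rewrite addr0 in h.
move: h; rewrite Zprod_inr add0r; case: (alpha =P [::]) => [_|/eqP a0]; first by rewrite eqxx.
rewrite mulf_eq0 negb_or => /andP[_ h]; apply/orP; right.
apply: (allpairs_f (fun a u => inl k :: inr a :: u)).
  by apply: uB => //; rewrite in_cons mem_head.
by apply: IH => // b bu; apply: uB; do 2!apply: (tl).
Qed.

Lemma Zprod_annihilated s u : Zprod s u != 0 -> annihilated u = s.
Proof.
elim: s u => [|k s IH] u; first by rewrite /= /fsum1; case: (u =P [::]) => [->|]; rewrite ?eqxx.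
rewrite Zprod_cons; case: u => [|o u]; first by rewrite eqxx.
case: (o =P inl k) => [->|]; last by rewrite mul0r eqxx.
rewrite mul1r fsum_mul_Theta => h; rewrite /annihilated /= -/(annihilated u); congr cons.
case: u h => [|[j|alpha] u]; rewrite ?addr0; [exact: IH|exact: IH|].
rewrite Zprod_inr add0r; case: (alpha =P [::]) => [_|_]; first by rewrite eqxx.
by rewrite mulf_eq0 negb_or => /andP[_ /IH].
Qed.

Definition short_words s : seq (seq K) := [seq w <- undup (words_upto s (size s)) | w != [::]].

Lemma short_words_uniq s : uniq (short_words s).
Proof. by rewrite filter_uniq // undup_uniq. Qed.

Lemma mem_short_words s w : w != [::] -> (size w <= size s)%N -> {subset w <= s} ->
  w \in short_words s.
Proof. by move=> w0 ws sub; rewrite mem_filter w0 mem_undup mem_words_upto. Qed.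

(** By homogeneity the words T_alpha that matter only use letters of s and are not
    longer than s. *)
Lemma omega_Zprod s : omega (Zprod s) =
  (foldr (Ztrunc (short_words s)) (vacuum R K) s)@_[::].
Proof.
rewrite -Z_choices_big ?filter_all // raddf_sum /=.
rewrite /omega (fsbigE (Z_choices (short_words s) s)) //.
- apply: eq_big => [u|u _]; first by rewrite mem_set.
  by rewrite /vacuum_term inner_vacuum mcoeffZ.
- by apply: Z_choices_uniq; exact: short_words_uniq.
move=> u _; apply: contraNeq => /vacuum_term_perm[Fu p]; apply: Z_choices_mem => // alpha au a0.
rewrite (Zprod_annihilated Fu) in p; apply: mem_short_words => //.
  by rewrite (perm_size p) size_created.
by move=> k ka; rewrite (perm_mem p); apply: mem_created au _ ka.
Qed.

Lemma Zprod_big n (alpha : 'I_n -> K) :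
  \big[@fsum_mul R I J/@fsum1 R I J]_(i < n) Z kappa z (alpha i) =
  Zprod [seq alpha i | i <- enum 'I_n].
Proof.
have -> : enum 'I_n = index_enum 'I_n by rewrite enumT [index_enum _]unlock.
by rewrite [in LHS]unlock /Zprod foldr_map.
Qed.

End Products.

(** * Bi-non-crossing partitions with open positions *)

Section OpenPartitions.
Context (n : nat) (chi : 'I_n -> bool).
Implicit Types (i j k x : 'I_n) (V W S : {set 'I_n}) (p : {set {set 'I_n}}).

(** The order of the positions along the boundary of the bi-non-crossing diagram:
    down the left side, then up the right side. *)
Definition bi_lt i j := if chi i then ~~ chi j || (i < j)%N else ~~ chi j && (j < i)%N.

Lemma perm_s_chi_seq : perm_eq (s_chi_seq chi) (enum 'I_n).
Proof.
apply: perm_trans (permEl (perm_filterC chi (enum 'I_n))).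
by rewrite perm_cat2l perm_rev.
Qed.

Lemma pairwise_s_chi_seq : pairwise bi_lt (s_chi_seq chi).
Proof.
have en := pairwise_enum_ord n.
rewrite pairwise_cat; apply/and3P; split.
- apply/allrelP => i j; rewrite mem_rev !mem_filter => /andP[ci _] /andP[cj _].
  by rewrite /bi_lt ci cj.
- rewrite (@eq_in_pairwise _ chi _ (fun s t : 'I_n => s < t)%N) ?filter_all //.
    by rewrite pairwise_filter.
  by move=> i j ci cj; rewrite /bi_lt (ci : chi i = true) (cj : chi j = true).
rewrite -sorted_pairwise; last first.
  by move=> j i k; rewrite /bi_lt; case: (chi i) (chi j) (chi k) => [] [] [] //=; lia.
rewrite rev_sorted sorted_pairwise; last first.
  by move=> j i k; rewrite /bi_lt; case: (chi i) (chi j) (chi k) => [] [] [] //=; lia.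
rewrite (@eq_in_pairwise _ (predC chi) _ (fun s t : 'I_n => s < t)%N) ?filter_all //.
  by rewrite pairwise_filter.
move=> i j /= ci cj; rewrite /bi_lt.
by rewrite (negPf (ci : ~~ chi i)) (negPf (cj : ~~ chi j)).
Qed.

Lemma s_chi_lt i j : ((s_chi chi)^-1%g i < (s_chi chi)^-1%g j)%N = bi_lt i j.
Proof.
set s := s_chi chi.
have h (k l : 'I_n) : (k < l)%N -> bi_lt (s k) (s l).
  have sz : size (s_chi_seq chi) = n by rewrite (perm_size perm_s_chi_seq) size_enum_ord.
  move=> kl; rewrite !permE /s_chi_fun (set_nth_default k l) ?sz //.
  by apply: (pairwiseP k pairwise_s_chi_seq); rewrite // unfold_in /= sz.
rewrite -[in RHS](permKV s i) -[in RHS](permKV s j).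
set k := (s^-1)%g i; set l := (s^-1)%g j.
case: (ltngtP k l) => [/h->//|/h lk|/val_inj ->]; apply/esym.
  by move: lk; rewrite /bi_lt; case: (chi (s l)) (chi (s k)) => [] [] //=; lia.
by rewrite /bi_lt; case: (chi (s l)) => //=; rewrite ltnn.
Qed.

Definition crossing V W := [exists a in V, exists b in W, exists c in V, exists d in W,
  [&& bi_lt a b, bi_lt b c & bi_lt c d]].

Lemma crossingP V W : reflect
  (exists a b c d, [/\ [&& a \in V, b \in W, c \in V & d \in W],
     bi_lt a b, bi_lt b c & bi_lt c d]) (crossing V W).
Proof.
apply: (iffP exists_inP) => [[a aV] /exists_inP[b bW] /exists_inP[c cV]|].
  by case/exists_inP => d dW /and3P[ab bc cd]; exists a, b, c, d; rewrite aV bW cV dW.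
case=> a [b [c [d [/and4P[aV bW cV dW] ab bc cd]]]].
exists a => //; apply/exists_inP; exists b => //; apply/exists_inP; exists c => //.
by apply/exists_inP; exists d => //; rewrite ab bc cd.
Qed.

Definition bi_noncrossing p := [forall V in p, forall W in p, crossing V W ==> (V == W)].

Lemma bi_noncrossingP p : reflect
  (forall V W, V \in p -> W \in p -> V != W -> ~~ crossing V W) (bi_noncrossing p).
Proof.
apply: (iffP forall_inP) => [h V W Vp Wp|h V Vp].
  by have /forall_inP/(_ W Wp)/implyP := h V Vp; apply: contraNN.
apply/forall_inP => W Wp; apply/implyP; apply: contraLR; exact: h.
Qed.

Lemma noncrossing_s_chi p :
  noncrossing [set ((s_chi chi)^-1)%g @: (V : {set 'I_n}) | V in p] = bi_noncrossing p.
Proof.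
set s := s_chi chi.
have im V (P : pred 'I_n) :
    [exists a in (s^-1)%g @: V, P a] = [exists a in V, P ((s^-1)%g a)].
  apply/exists_inP/exists_inP => [[_ /imsetP[a aV ->] Pa]|[a aV Pa]]; first by exists a.
  by exists ((s^-1)%g a) => //; apply: imset_f.
have imX V W : [exists a in (s^-1)%g @: V, exists b in (s^-1)%g @: W,
    exists c in (s^-1)%g @: V, exists d in (s^-1)%g @: W,
      [&& (a < b)%N, (b < c)%N & (c < d)%N]] = crossing V W.
  rewrite im; apply: eq_existsb => a; congr andb; rewrite im.
  apply: eq_existsb => b; congr andb; rewrite im.
  apply: eq_existsb => c; congr andb; rewrite im.
  by apply: eq_existsb => d; rewrite !s_chi_lt.
apply/forall_inP/forall_inP => h.
  move=> V Vp; apply/forall_inP => W Wp; rewrite -imX.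
  have /forall_inP/(_ _ (imset_f _ Wp)) := h _ (imset_f _ Vp).
  by rewrite (inj_eq (imset_inj perm_inj)).
move=> _ /imsetP[V Vp ->]; apply/forall_inP => _ /imsetP[W Wp ->].
rewrite imX (inj_eq (imset_inj perm_inj)).
by have /forall_inP/(_ _ Wp) := h _ Vp.
Qed.

(** V crosses the pair formed by x and a point placed after all of V: some element of V lies
    between x and that point along the boundary, and some element does not. *)
Definition separated V x :=
  [exists v in V, (chi v == chi x) && (x < v)%N] &&
  [exists w in V, (chi w != chi x) || (w < x)%N].

Lemma separatedP V x : reflect
  (exists v w, [/\ v \in V, w \in V, (chi v == chi x) && (x < v)%N
                 & (chi w != chi x) || (w < x)%N]) (separated V x).
Proof.
apply: (iffP andP) => [[/exists_inP[v vV hv] /exists_inP[w wV hw]]|].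
  by exists v, w.
by case=> v [w [vV wV hv hw]]; split; apply/exists_inP; [exists v|exists w].
Qed.

Definition below (m : nat) := [set i : 'I_n | (i < m)%N].

(** As W precedes k, the position k plays the part of the point at the bottom, and
    a crossing of W with a block through k can be moved to one that uses k. *)
Lemma crossing_separated k V W : V \subset below k -> W \subset below k ->
  [disjoint V & W] ->
  crossing (k |: V) W || crossing W (k |: V) = [exists x in V, separated W x].
Proof.
move=> /subsetP Vk /subsetP Wk VW.
have lt_k (U : {set 'I_n}) y : {subset U <= below k} -> y \in U -> (y < k)%N.
  by move=> h /h; rewrite inE.
have neq x y : x \in V -> y \in W -> x <> y :> nat.
  by move=> xV yW /val_inj e; rewrite e (disjointFl VW yW) in xV.
apply/idP/exists_inP => [|[x xV /separatedP[v [w [vW wW hv hw]]]]]; last first.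
  have vk := lt_k _ _ Wk vW; have wk := lt_k _ _ Wk wW; have xk := lt_k _ _ Vk xV.
  have xw := neq _ _ xV wW.
  have VkU : k \in k |: V by rewrite setU11.
  have xU : x \in k |: V by rewrite setU1r.
  case/andP: hv => /eqP cv xv.
  have [h|h] : [&& bi_lt x v, bi_lt v k & bi_lt k w] || [&& bi_lt k v, bi_lt v x & bi_lt x w]
    \/ [&& bi_lt w x, bi_lt x v & bi_lt v k] || [&& bi_lt w k, bi_lt k v & bi_lt v x].
  - apply/orP; move: hw; rewrite /bi_lt cv.
    by case: (chi x) (chi w) (chi k) => [] [] [] //=; lia.
  - apply/orP; left; apply/crossingP.
    case/orP: h => /and3P[h1 h2 h3]; [exists x, v, k, w | exists k, v, x, w];
      by split; rewrite ?VkU ?xU ?vW ?wW.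
  apply/orP; right; apply/crossingP.
  case/orP: h => /and3P[h1 h2 h3]; [exists w, x, v, k | exists w, k, v, x];
    by split; rewrite ?VkU ?xU ?vW ?wW.
pose sep2 x v w := (chi v == chi x) && (x < v)%N && ((chi w != chi x) || (w < x)%N).
have sepI x v w : x \in V -> v \in W -> w \in W -> sep2 x v w || sep2 x w v ->
    exists2 x, x \in V & separated W x.
  by move=> xV vW wW /orP[] /andP[h1 h2]; exists x => //; apply/separatedP;
    [exists v, w | exists w, v].
have main a b c d : a \in k |: V -> b \in W -> c \in k |: V -> d \in W ->
    [&& bi_lt a b, bi_lt b c & bi_lt c d] || [&& bi_lt b a, bi_lt a d & bi_lt d c] ->
    exists2 x, x \in V & separated W x.
  move=> aU bW cU dW h.
  have leU y : y \in k |: V -> ((y <= k)%N * ((y < k)%N -> y \in V))%type.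
    by rewrite in_setU1 => /predU1P[->|yV]; rewrite ?ltnn // ltnW ?(lt_k _ _ Vk yV).
  have [ak aV] := leU a aU; have [ck cV] := leU c cU.
  have bk := lt_k _ _ Wk bW; have dk := lt_k _ _ Wk dW.
  have : ((a < k)%N && (sep2 a b d || sep2 a d b)) ||
         ((c < k)%N && (sep2 c b d || sep2 c d b)).
    move: h; rewrite /sep2 /bi_lt.
    by case: (chi a) (chi b) (chi c) (chi d) => [] [] [] [] //=; lia.
  by case/orP=> /andP[xk hx]; [apply: sepI (aV xk) bW dW hx | apply: sepI (cV xk) bW dW hx].
case/orP => /crossingP[a [b [c [d [/and4P[aV bW cV dW] h1 h2 h3]]]]].
  by apply: (main a b c d); rewrite ?h1 ?h2 ?h3.
by apply: (main b a d c); rewrite ?h1 ?h2 ?h3 ?orbT.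
Qed.

(** S is the set of positions that belong to blocks with an element at m or later;
    with respect to p these blocks act as one block through a point at the bottom. *)
Definition open_partition (m : nat) S p :=
  [&& partition p (below m :\: S), bi_noncrossing p &
      [forall V in p, forall x in S, ~~ separated V x]].

Lemma open_partitionP m S p : reflect
  [/\ partition p (below m :\: S),
      forall V W, V \in p -> W \in p -> V != W -> ~~ crossing V W &
      forall V x, V \in p -> x \in S -> ~~ separated V x] (open_partition m S p).
Proof.
apply: (iffP and3P) => -[h1 h2 h3]; split=> //.
- exact/bi_noncrossingP.
- by move=> V x Vp xS; apply: (forall_inP (forall_inP h3 V Vp)).
- exact/bi_noncrossingP.
by apply/forall_inP => V Vp; apply/forall_inP => x xS; apply: h3.
Qed.

Lemma below0 : below 0 = set0.
Proof. by apply/setP => i; rewrite !inE. Qed.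

Lemma belowS k : below k.+1 = k |: below k.
Proof. by apply/setP => i; rewrite !inE ltnS leq_eqVlt. Qed.

(** Opening the last position k imposes nothing: no block of earlier positions
    separates it from the bottom. *)
Lemma open_partition_below k S p : S \subset below k ->
  open_partition k.+1 (k |: S) p = open_partition k S p.
Proof.
move=> Sk; have kS : k \notin S by apply/negP => /(subsetP Sk); rewrite inE ltnn.
have e : below k.+1 :\: (k |: S) = below k :\: S.
  by apply/setP => i; rewrite belowS !inE; case: (eqVneq i k) => [->|]; rewrite ?ltnn ?andbF.
apply/open_partitionP/open_partitionP => -[]; rewrite ?e => h1 h2 h3; split; rewrite ?e //.
  by move=> V x Vp xS; apply: h3; rewrite // setU1r.
move=> V x Vp /setU1P[->|]; last exact: h3.
apply/negP => /separatedP[v [_ [vV _ /andP[_ kv] _]]].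
have := subsetP (partitionS h1 Vp) v vV; rewrite !inE => /andP[_].
by rewrite ltnNge ltnW.
Qed.

(** The block of k and V can be opened while the positions in S are open. *)
Definition openable k V S := [forall x in S, ~~ separated (k |: V) x].

(** Once its largest element k is removed, a block becomes a set V of open
    positions: not crossing it is the same as not separating any of them. *)
Lemma open_partition_block k V S p : S \subset below k -> V \subset below k :\: S ->
  k |: V \notin p ->
  open_partition k.+1 S ((k |: V) |: p) = openable k V S && open_partition k (S :|: V) p.
Proof.
move=> Sk Vk nVp.
have kS : k \notin S by apply/negP => /(subsetP Sk); rewrite inE ltnn.
have Vb : V \subset below k := subset_trans Vk (subsetDl _ _).
have kV : k \notin V by apply/negP => /(subsetP Vb); rewrite inE ltnn.
have e : (below k.+1 :\: S) :\: (k |: V) = below k :\: (S :|: V).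
  apply/setP => i; rewrite belowS !inE.
  by case: (eqVneq i k) => [->|]; rewrite ?ltnn ?andbF //= !negb_or andbCA andbA.
have Us : k |: V \subset below k.+1 :\: S.
  rewrite subUset sub1set belowS !inE kS eqxx /=.
  by apply: subset_trans Vk _; apply: setSD; exact: subsetUr.
have crossE W : W \in p -> partition p (below k :\: (S :|: V)) ->
    crossing (k |: V) W || crossing W (k |: V) = [exists x in V, separated W x].
  move=> Wp pP; have Wb := partitionS pP Wp.
  apply: crossing_separated => //; first exact: subset_trans Wb (subsetDl _ _).
  rewrite disjoint_sym; apply/pred0P => x /=; apply/negP => /andP[/(subsetP Wb)].
  by rewrite !inE negb_or => /andP[/andP[_ /negPf->]].
apply/open_partitionP/andP => [[h1 h2 h3]|[h4 /open_partitionP[h1 h2 h3]]].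
  have pP : partition p (below k :\: (S :|: V)).
    rewrite -e; have := partitionD1 h1 (setU11 _ _).
    by rewrite setU1K.
  split; first by apply/forall_inP => x xS; apply: h3 => //; rewrite setU11.
  apply/open_partitionP; split=> //.
    by move=> W W' Wp W'p; apply: h2; rewrite setU1r.
  move=> W x Wp /setUP[|xV]; first by apply: h3; rewrite setU1r.
  have nW : k |: V != W by apply: contraNneq nVp => ->.
  have := crossE W Wp pP; rewrite (negPf (h2 _ _ _ _ nW)) ?setU11 ?setU1r //.
  rewrite (negPf (h2 _ _ _ _ _)) ?setU11 ?setU1r 1?eq_sym // => /esym/exists_inPn; exact.
split.
- have -> : below k.+1 :\: S = (k |: V) :|: (below k :\: (S :|: V)).
    by rewrite -e -{1}(setID (below k.+1 :\: S) (k |: V)) (setIidPr Us).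
  apply: partitionU1 h1 _ _; first by apply/set0Pn; exists k; rewrite setU11.
  by rewrite -e -setI_eq0 setIDA setD_eq0 subsetIl.
- move=> W W' /setU1P[->|Wp] /setU1P[->|W'p]; rewrite ?eqxx // => ne; last exact: h2.
    apply/negP => c; have := crossE W' W'p h1; rewrite c /= => /esym/exists_inP[x xV].
    by apply/negP/h3; rewrite // inE xV orbT.
  apply/negP => c; have := crossE W Wp h1; rewrite c orbT => /esym/exists_inP[x xV].
  by apply/negP/h3; rewrite // inE xV orbT.
move=> W x /setU1P[->|Wp] xS; first exact: (forall_inP h4).
by apply: h3; rewrite // inE xS.
Qed.

Section Sums.
Context (R : comNzRingType) (f : {set 'I_n} -> R).

Definition open_sum (m : nat) S : R :=
  \sum_(p | open_partition m S p) \prod_(V in p) f V.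

Lemma open_sum0 : open_sum 0 set0 = 1.
Proof.
rewrite /open_sum (bigD1 set0) ?big_set0 /= ?big1 ?addr0 //.
  by move=> p /andP[/and3P[]]; rewrite below0 set0D partition_set0 => ->.
apply/open_partitionP; split; last by move=> V x; rewrite inE.
  by rewrite below0 set0D partition_set0.
by move=> V W; rewrite inE.
Qed.

Lemma open_sum_below k S : S \subset below k ->
  open_sum k.+1 (k |: S) = open_sum k S.
Proof. by move=> Sk; apply: eq_bigl => p; rewrite open_partition_below. Qed.

(** Classify the partitions by the block of k. *)
Lemma open_sum_block k S : S \subset below k ->
  open_sum k.+1 S =
  \sum_(V : {set 'I_n} | (V \subset below k :\: S) && openable k V S)
    f (k |: V) * open_sum k (S :|: V).
Proof.
move=> Sk; have kS : k \notin S by apply/negP => /(subsetP Sk); rewrite inE ltnn.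
have kV V : V \subset below k :\: S -> k \notin V.
  by move=> Vk; apply/negP => /(subsetP Vk); rewrite !inE ltnn andbF.
have kp V p : open_partition k (S :|: V) p -> k |: V \notin p.
  case/and3P => pP _ _; apply/negP => /(partitionS pP)/subsetP/(_ k (setU11 _ _)).
  by rewrite !inE ltnn andbF.
have blk p : open_partition k.+1 S p ->
    exists2 V : {set 'I_n}, pblock p k = k |: V &
      [/\ k |: V \in p, V \subset below k :\: S & openable k V S].
  move=> op; have /and3P[pP _ _] := op.
  have kc : k \in cover p by rewrite (cover_partition pP) !inE kS /=.
  have Bp := pblock_mem kc; have kB : k \in pblock p k by rewrite mem_pblock.
  have E := setD1K kB; exists (pblock p k :\ k); first by rewrite E.
  have Vk : pblock p k :\ k \subset below k :\: S.
    apply/subsetP => i; rewrite in_setD1 => /andP[ik iB].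
    by have := subsetP (partitionS pP Bp) i iB; rewrite belowS !inE (negPf ik).
  rewrite E; split=> //.
  have := open_partition_block (p := p :\ pblock p k) Sk Vk.
  by rewrite E setD11 setD1K // op => /(_ isT)/esym/andP[].
rewrite /open_sum (partition_big (fun p => pblock p k :\ k)
   (fun V => (V \subset below k :\: S) && openable k V S)) /=; last first.
  by move=> p /blk[V -> [_ Vk]]; rewrite setU1K ?kV // Vk.
apply: eq_bigr => V /andP[Vk ex]; rewrite mulr_sumr.
rewrite (reindex_onto (fun p => (k |: V) |: p) (fun p => p :\ (k |: V))) /=; last first.
  move=> p /andP[/blk[W eW [Wp Wk _]]]; rewrite eW setU1K ?kV // => /eqP <-.
  by rewrite setD1K.
apply: eq_big => [p|p].
  apply/idP/idP => [/andP[/andP[op _] /eqP e]|op].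
    have nVp : k |: V \notin p by rewrite -e setD11.
    by move: op; rewrite open_partition_block // => /andP[].
  have nVp := kp _ _ op; rewrite open_partition_block // ex op /=.
  rewrite setU1K // eqxx andbT.
  have op' : open_partition k.+1 S ((k |: V) |: p).
    by rewrite open_partition_block // ex op.
  have /and3P[/partition_trivIset tI _ _] := op'.
  by rewrite (def_pblock tI (B := k |: V)) ?setU11 // setU1K ?kV.
by move=> /andP[_ /eqP e]; rewrite big_setU1 // -e setD11.
Qed.

End Sums.

Lemma open_partition_BNC p : open_partition n set0 p = (p \in BNC chi).
Proof.
rewrite inE noncrossing_s_chi /open_partition setD0.
have -> : below n = [set: 'I_n] by apply/setP => i; rewrite !inE ltn_ord.
case: (partition _ _) => //=; rewrite -[RHS]andbT; congr andb.
by apply/forall_inP => V _; apply/forall_inP => x; rewrite inE.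
Qed.

End OpenPartitions.

(** * Sums over subsets *)

Lemma big_subsets_setU1 (R : nmodType) (T : finType) (x : T) (Q : {set T})
    (c : pred {set T}) (F : {set T} -> R) : x \notin Q ->
  \sum_(V : {set T} | (V \subset x |: Q) && c V) F V =
  \sum_(V : {set T} | (V \subset Q) && c V) F V +
  \sum_(V : {set T} | (V \subset Q) && c (x |: V)) F (x |: V).
Proof.
move=> xQ; have xV (V : {set T}) : V \subset Q -> x \notin V.
  by move=> /subsetP VQ; apply/negP => /VQ; rewrite (negPf xQ).
rewrite (bigID (fun V : {set T} => x \in V)) /= addrC; congr (_ + _).
  apply: eq_bigl => V; rewrite andbAC; congr andb.
  apply/andP/idP => [[VQ nx]|VQ]; last by rewrite xV // (subset_trans VQ) // subsetUr.
  apply/subsetP => y yV; have /setU1P[e|//] := subsetP VQ y yV.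
  by rewrite -e yV in nx.
rewrite (reindex_onto (fun V => x |: V) (fun V => V :\ x)) /=; last first.
  by move=> V /andP[_ xV']; rewrite setD1K.
apply: eq_bigl => V; rewrite setU11 andbT andbAC; congr andb.
apply/andP/idP => [[h /eqP e]|VQ]; last by rewrite setUS // setU1K // xV.
apply/subsetP => y yV; have /setU1P[e'|//] := subsetP h y (setU1r _ yV).
by move: yV; rewrite -e e' setD11.
Qed.

Lemma setDUK_sub (T : finType) (V S : {set T}) : V \subset S -> (S :\: V) :|: V = S.
Proof. by move=> VS; rewrite -[RHS](setID S V) (setIidPr VS) setUC. Qed.

Lemma big_subsets_split (R : nmodType) (T : finType) (b : {set T})
    (c : rel {set T}) (F : {set T} -> {set T} -> R) :
  \sum_(S : {set T} | S \subset b) \sum_(V : {set T} | (V \subset S) && c V (S :\: V))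
     F V (S :\: V) =
  \sum_(S : {set T} | S \subset b) \sum_(V : {set T} | (V \subset b :\: S) && c V S) F V S.
Proof.
rewrite (exchange_big_dep (fun V : {set T} => V \subset b)) /=; last first.
  by move=> S V Sb /andP[VS _]; exact: subset_trans VS Sb.
rewrite [RHS](exchange_big_dep (fun V : {set T} => V \subset b)) /=; last first.
  by move=> S V Sb /andP[VS _]; exact: subset_trans VS (subsetDl _ _).
apply: eq_bigr => V Vb.
rewrite (reindex_onto (fun S => S :|: V) (fun S => S :\: V)) /=; last first.
  by move=> S /and3P[_ VS _]; rewrite setDUK_sub.
apply: eq_big => [S|S /andP[_ /eqP->]//].
rewrite subUset Vb andbT subsetUr /= setDUl setDv setU0.
have -> : (S :\: V == S) = [disjoint V & S].
  by rewrite disjoint_sym; apply/eqP/setDidPl.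
rewrite subsetD Vb /=; case: (boolP [disjoint V & S]) => [d|]; last by rewrite !andbF.
by rewrite andbT (setDidPl _) // disjoint_sym.
Qed.

Lemma sum_delta (R : pzSemiRingType) (T : eqType) (r : seq T) (F : T -> R) (t : T) :
  uniq r -> \sum_(u <- r) F u * (t == u)%:R = if t \in r then F t else 0.
Proof.
move=> ur; case: ifPn => tr; last first.
  by apply: big1_seq => u /= ur'; case: eqP => [e|]; [rewrite e ur' in tr|rewrite mulr0].
rewrite (bigD1_seq t) //= eqxx mulr1 big1 ?addr0 // => u.
by rewrite eq_sym => /negPf->; rewrite mulr0.
Qed.

Section Subsets.
Context (K : eqType) (n : nat) (alpha : 'I_n -> K) (P : pred K).

(** The positions q spell a word, and V marks those that come from the new block. An
    entry that precedes an entry of the other kind is read while both words still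
    have letters, so its colour must decide its kind, as in [bishuffle]. *)
Definition forced_split (V : {set 'I_n}) (q : seq 'I_n) :=
  pairwise (fun i j => ((i \in V) != (j \in V)) ==> ((i \in V) == P (alpha i))) q.

(** If the first entry x of q is read against its colour, all later entries are of the
    same kind as x, which leaves a single V; this is the case of an exhausted word. *)
Lemma bishuffle_subsets (R : comNzRingType) u v (q : seq 'I_n) : uniq q ->
  (bishuffle P u v (map alpha q))%:R =
  \sum_(V : {set 'I_n} | (V \subset [set i in q]) && forced_split V q)
    ((map alpha [seq i <- q | i \in V] == u) &&
     (map alpha [seq i <- q | i \notin V] == v))%:R :> R.
Proof.
elim: q u v => [|x q IH] u v.
  move=> _; rewrite (bigD1 set0) ?sub0set //= big1 ?addr0.
    by rewrite ![[::] == _]eq_sym.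
  move=> V /andP[/andP[]]; have -> : [set i in [::]] = set0 :> {set 'I_n}.
    by apply/setP => i; rewrite !inE.
  by rewrite subset0 => /eqP->; rewrite eqxx.
move=> /= /andP[xq uq].
have -> : [set i in x :: q] = x |: [set i in q] by apply/setP => i; rewrite !inE.
rewrite big_subsets_setU1 ?inE //.
have xV (V : {set 'I_n}) : V \subset [set i in q] -> x \notin V.
  by move=> /subsetP VQ; apply/negP => /VQ; rewrite inE (negPf xq).
have memU (V : {set 'I_n}) y : y \in q -> (y \in x |: V) = (y \in V).
  by move=> yq; rewrite in_setU1; case: eqP => // e; rewrite -e yq in xq.
have okU (V : {set 'I_n}) : forced_split (x |: V) q = forced_split V q.
  apply: (@eq_in_pairwise _ (mem q)); last by apply/allP.
  by move=> i j iq jq /=; rewrite !memU.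
have filU (V : {set 'I_n}) : [seq i <- q | i \in x |: V] = [seq i <- q | i \in V].
  by apply: eq_in_filter => i; apply: memU.
have filUC (V : {set 'I_n}) : [seq i <- q | i \notin x |: V] = [seq i <- q | i \notin V].
  by apply: eq_in_filter => i /memU ->.
have sum0 (c : pred {set 'I_n}) (F : {set 'I_n} -> R) (D : {set 'I_n}) :
    D \subset [set i in q] -> (forall V : {set 'I_n}, V \subset [set i in q] -> c V = (V == D)) ->
    \sum_(V : {set 'I_n} | (V \subset [set i in q]) && c V) F V = F D.
  move=> Dq cD; rewrite (big_pred1 D) // => V /=.
  case: (boolP (V \subset _)) => [/cD->//|]; case: eqP => // ->; by rewrite Dq.
have okD (D : {set 'I_n}) b : (forall i, i \in q -> (i \in D) = b) -> forced_split D q.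
  move=> Db; rewrite /forced_split (@eq_in_pairwise _ (mem q) _ (fun _ _ => true)).
  - by elim: (q) => //= y r ->; rewrite andbT all_predT.
  - by move=> i j iq jq /=; rewrite !Db // eqxx.
  by apply/allP.
case: (boolP (P (alpha x))) => Px.
  rewrite (sum0 _ _ set0) ?sub0set //; last first.
    move=> V Vq; rewrite [LHS]/= (negPf (xV V Vq)); apply/andP/eqP => [[h _]|->].
      apply/setP => i; rewrite inE; apply/negP => iV.
      have iq : i \in q by have := subsetP Vq i iV; rewrite inE.
      by have := allP h i iq; rewrite iV.
    by split; [apply/allP => i _; rewrite inE|apply: (okD _ false) => i _; rewrite inE].
  rewrite in_set0 /= (eq_filter (a2 := pred0)); last by move=> i; rewrite inE.
  rewrite filter_pred0 (eq_filter (a2 := predT)); last by move=> i; rewrite inE.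
  rewrite filter_predT.
  transitivity ((([::] == u) && (map alpha (x :: q) == v))%:R +
     (if u is y :: u' then ((y == alpha x) && bishuffle P u' v (map alpha q))%:R else 0) : R).
    by case: (u) => [|y u'] /=; rewrite ?addr0 ?add0r // eq_sym.
  congr (_ + _); case: u => [|y u].
    by rewrite big1 // => V _; rewrite setU11.
  rewrite -mulnb natrM IH // mulr_sumr; apply: eq_big => V.
    case: (boolP (V \subset _)) => //= Vq; rewrite okU; case: allP => // -[] j jq.
    by rewrite setU11 ?Px implybT.
  by move=> _; rewrite setU11 /= filU filUC eqseq_cons [alpha x == y]eq_sym -natrM mulnb andbA.
rewrite addrC (sum0 _ _ [set i in q]) //; last first.
  move=> V Vq; rewrite [LHS]/= setU11; apply/andP/eqP => [[h _]|->].
    apply/eqP; rewrite eqEsubset Vq; apply/subsetP => i; rewrite inE => iq.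
    by have := allP h i iq; rewrite memU //; case: (i \in V).
  split; first by apply/allP => i iq; rewrite memU // inE iq.
  by rewrite okU; apply: (okD _ true) => i iq; rewrite inE.
rewrite setU11 /= filU filUC.
rewrite (eq_in_filter (a2 := predT)); last by move=> i iq; rewrite inE.
rewrite filter_predT (eq_in_filter (a2 := pred0)); last by move=> i iq; rewrite inE iq.
rewrite filter_pred0.
transitivity (((map alpha (x :: q) == u) && ([::] == v))%:R +
   (if v is y :: v' then ((y == alpha x) && bishuffle P u v' (map alpha q))%:R else 0) : R).
  rewrite /= ?(negPf Px).
  by case: (v) => [|y v'] /=; rewrite ?andbT ?andbF ?addr0 ?add0r // eq_sym.
congr (_ + _); case: v => [|y v].
  by rewrite big1 // => V /andP[/xV/negPf-> _]; rewrite andbF.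
rewrite -mulnb natrM IH // mulr_sumr; apply: eq_big => V.
  case: (boolP (V \subset _)) => //= Vq; case: allP => // -[] j jq.
  by rewrite (negPf (xV V Vq)) ?(negPf Px) implybT.
move=> /andP[/xV xnV _]; rewrite (negPf xnV) /= eqseq_cons [alpha x == y]eq_sym -natrM mulnb.
by rewrite andbCA.
Qed.

End Subsets.

(** Turns a condition on the order of occurrence in q into one on an order relation
    for which q is sorted. *)
Lemma pairwise_orderP (T : eqType) (r s : rel T) (q : seq T) :
  pairwise s q -> (forall i j, s i j -> ~~ s j i) ->
  reflect {in q &, forall i j, s i j -> r i j} (pairwise r q).
Proof.
move=> sq asym; apply: (iffP idP) => [rq i j iq jq sij|h].
  have a := pairwiseP i rq; have b := pairwiseP i sq.
  have [ii jj] : (index i q < size q)%N /\ (index j q < size q)%N by rewrite !index_mem.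
  rewrite -(nth_index i iq) -(nth_index i jq).
  case: (ltngtP (index i q) (index j q)) => ij; first exact: a.
    by have := b _ _ jj ii ij; rewrite !nth_index // => /asym; rewrite sij.
  have e : i = j by rewrite -(nth_index i iq) ij nth_index.
  by have := asym _ _ sij; rewrite e in sij *; rewrite sij.
case: q sq h => // x q sq h; apply/(pairwiseP x) => a b aq bq ab.
by apply: h; rewrite ?mem_nth //; apply: (pairwiseP x sq).
Qed.

(** * Tensors as sets of open positions *)

Section EnumOrd.
Context (n : nat).
Implicit Types (k : 'I_n) (S V : {set 'I_n}).

Lemma pairwise_enum S : pairwise (fun i j : 'I_n => i < j)%N (enum S).
Proof.
have -> : enum S = [seq i <- enum 'I_n | i \in S] by rewrite enumT.
exact: pairwise_filter (pairwise_enum_ord n).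
Qed.

Lemma enum_eq S (q : seq 'I_n) : pairwise (fun i j : 'I_n => i < j)%N q ->
  (forall i, (i \in q) = (i \in S)) -> enum S = q.
Proof.
move=> pq mq; have tr : transitive (fun i j : 'I_n => i < j)%N.
  by move=> j i k; apply: ltn_trans.
apply: (irr_sorted_eq tr) => [i||| i]; rewrite ?ltnn //.
- by rewrite sorted_pairwise // pairwise_enum.
- by rewrite sorted_pairwise.
by rewrite mem_enum mq.
Qed.

Lemma enum_setU1_below k S : S \subset below n k -> enum (k |: S) = rcons (enum S) k.
Proof.
move=> /subsetP Sk; apply: enum_eq => [|i].
  rewrite pairwise_rcons pairwise_enum andbT; apply/allP => i; rewrite mem_enum.
  by move/Sk; rewrite inE.
by rewrite mem_rcons in_cons mem_enum in_setU1.
Qed.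

Lemma filter_rev_enum (C : pred 'I_n) S :
  [seq i <- rev (enum S) | C i] = rev (enum [set i in S | C i]).
Proof.
rewrite filter_rev; congr rev; apply/esym/enum_eq.
  exact: pairwise_filter (pairwise_enum _).
by move=> i; rewrite mem_filter mem_enum inE andbC.
Qed.

End EnumOrd.

Section Model.
Context (R : realType) (I J : choiceType) (A : algType R[i]).
Context (kappa : functionals A) (z : I + J -> A).
Local Notation K := (I + J)%type.
Context (n : nat) (alpha : 'I_n -> K).
Implicit Types (k : 'I_n) (S V : {set 'I_n}).
Local Notation chi := (fun i => side (alpha i)).
Local Notation below := (below n).

(** The tensor spelled by the open positions S; the last position is annihilated
    first, so it comes first. *)
Definition set_word S : seq K := [seq alpha i | i <- rev (enum S)].
Definition block_cumulant V : R[i] := kappa_word kappa z [seq alpha i | i <- enum V].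

Lemma set_word0 : set_word set0 = [::].
Proof. by rewrite /set_word enum_set0. Qed.

Lemma set_word_eq0 S : (set_word S == [::]) = (S == set0).
Proof.
apply/eqP/eqP => [|->]; last exact: set_word0.
move/(congr1 size); rewrite size_map size_rev -cardE => /eqP.
by rewrite cards_eq0 => /eqP.
Qed.

Lemma set_word_setU1 k S : S \subset below k -> set_word (k |: S) = alpha k :: set_word S.
Proof. by move=> Sk; rewrite /set_word enum_setU1_below // rev_rcons. Qed.

(** The combinatorial core: the order in which T allows the letters to be interleaved
    is the condition that the new block crosses no open block. Membership of k in
    the block supplies one of the two witnesses of each separation. *)
Lemma forced_split_openable k S V : S \subset below k -> V \subset S ->
  forced_split alpha (same_side (alpha k)) V (rev (enum S)) = openable chi k V (S :\: V).
Proof.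
move=> /subsetP Sk /subsetP VS.
have lt_k i : i \in S -> (i < k)%N by move/Sk; rewrite inE.
have pq : pairwise (fun i j : 'I_n => j < i)%N (rev (enum S)).
  rewrite -sorted_pairwise; last by move=> j i l ij jl; apply: ltn_trans jl ij.
  rewrite rev_sorted sorted_pairwise; last by move=> j i l; apply: ltn_trans.
  exact: pairwise_enum.
have asym (i j : 'I_n) : (j < i)%N -> ~~ (i < j)%N by move=> ji; rewrite -leqNgt ltnW.
apply/(pairwise_orderP _ pq asym)/forall_inP => [h x|h i j].
  rewrite inE => /andP[xV xS]; apply/negP => /separatedP[v [w [vU wU hv hw]]].
  have H i j : i \in S -> j \in S -> (j < i)%N -> (i \in V) != (j \in V) ->
      (i \in V) = (chi i == chi k).
    move=> iS jS; have := h i j; rewrite !mem_rev !mem_enum iS jS => /(_ isT isT) h' /h'.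
    by move/implyP=> {}h' /h' /eqP.
  have Hv : v \in V -> (x < v)%N -> chi v = chi k.
    by move=> vV xv; have := H v x (VS v vV) xS xv; rewrite vV (negPf xV) => /(_ isT)/esym/eqP.
  have Hw : w \in V -> (w < x)%N -> chi x != chi k.
    by move=> wV wx; have := H x w xS (VS w wV) wx; rewrite wV (negPf xV) => /(_ isT) <-.
  have Hw' : w \in V -> (x < w)%N -> chi w = chi k.
    by move=> vV xv; have := H w x (VS w vV) xS xv; rewrite vV (negPf xV) => /(_ isT)/esym/eqP.
  have xk := lt_k x xS.
  have wx : w \in V -> w <> x :> nat by move=> wV /val_inj e; rewrite -e wV in xV.
  case/andP: hv => /eqP cv xv.
  have cx : chi x = chi k by case/setU1P: vU => [vk|vV]; rewrite -cv ?vk // Hv.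
  case/setU1P: wU hw => [->|wV]; first by rewrite cx eqxx /= ltnNge ltnW.
  case: (ltngtP w x) => // [/(Hw wV)|/(Hw' wV) -> |/(wx wV)//]; rewrite cx ?eqxx //.
rewrite !mem_rev !mem_enum => iS jS ji; apply/implyP => ne; apply/eqP.
have ext x : x \in S -> x \notin V -> forall v w, v \in k |: V -> w \in k |: V ->
    (chi v == chi x) && (x < v)%N -> (chi w != chi x) || (w < x)%N -> False.
  move=> xS xV v w vU wU hv hw; have xD : x \in S :\: V by rewrite inE xV.
  by have /negP := h x xD; apply; apply/separatedP; exists v, w.
have kU := setU11 k V; rewrite /same_side.
case: (boolP (i \in V)) ne => iV; case: (boolP (j \in V)) => // jV _.
  apply/esym/negPn/negP => ci; case: (eqVneq (chi j) (chi i)) => cij.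
    apply: (ext j jS jV i k) => //; first exact: setU1r.
      by rewrite cij eqxx.
    by rewrite cij eq_sym ci.
  apply: (ext j jS jV k i) => //; first exact: setU1r; last by rewrite eq_sym cij.
  rewrite lt_k // andbT; move: ci cij; rewrite /same_side.
  by case: (side (alpha i)) (side (alpha j)) (side (alpha k)) => [] [] [].
apply/esym/negbTE/negP => ci; apply: (ext i iS iV k j) => //; first exact: setU1r.
  by rewrite eq_sym ci lt_k.
by rewrite ji orbT.
Qed.

(** Each way to obtain the tensor spelled by S splits S into the positions V just
    opened and those that were open before. *)
Lemma T_basis_subsets k S beta eta : S \subset below k -> beta != [::] ->
  (T_basis R beta eta)@_(alpha k :: set_word S) =
  \sum_(V : {set 'I_n} | (V \subset S) && openable chi k V (S :\: V))
    ([seq alpha i | i <- enum (k |: V)] == beta)%:R * (set_word (S :\: V) == eta)%:R.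
Proof.
move=> Sk b0; case e: (rev beta) => [|b rb].
  by case/eqP: b0; rewrite -[beta]revK e.
have eb : beta = rcons (rev rb) b by rewrite -[LHS]revK e rev_cons.
have uS : uniq (rev (enum S)) by rewrite rev_uniq enum_uniq.
rewrite (T_basis_coeff _ _ _ e); case: (eqVneq (alpha k) b) => [<-{b e}|kb] in eb *; last first.
  rewrite big1 // => V /andP[VS _].
  by rewrite enum_setU1_below ?(subset_trans VS) // map_rcons eb eqseq_rcons (negPf kb) andbF mul0r.
rewrite /= (bishuffle_subsets _ _ _ _ _ uS).
have -> : [set i in rev (enum S)] = S by apply/setP => i; rewrite inE mem_rev mem_enum.
apply: eq_big => [V|V /andP[VS _]].
  by case: (boolP (V \subset S)) => //= VS; apply: forced_split_openable.
rewrite !filter_rev_enum; have -> : [set i in S | i \in V] = V.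
  by apply/setP => i; rewrite inE andb_idl // => /(subsetP VS).
have -> : [set i in S | i \notin V] = S :\: V by apply/setP => i; rewrite !inE andbC.
rewrite enum_setU1_below ?(subset_trans VS) // map_rcons eb eqseq_rcons.
have -> : (map alpha (rev (enum V)) == rb) = (map alpha (enum V) == rev rb).
  by rewrite map_rev -(inj_eq (can_inj (@revK _))) revK.
by rewrite eqxx andbT -natrM mulnb.
Qed.

Local Notation B := (short_words [seq alpha i | i <- enum 'I_n]).

Lemma T_op_subsets k S (x : fock R K) : S \subset below k ->
  \sum_(beta <- B) kappa_word kappa z beta * (T_op beta x)@_(alpha k :: set_word S) =
  \sum_(V : {set 'I_n} | (V \subset S) && openable chi k V (S :\: V))
    block_cumulant (k |: V) * x@_(set_word (S :\: V)).
Proof.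
move=> Sk.
pose b V := [seq alpha i | i <- enum (k |: V)].
transitivity (\sum_(V : {set 'I_n} | (V \subset S) && openable chi k V (S :\: V))
   (\sum_(beta <- B) kappa_word kappa z beta * (b V == beta)%:R) *
   (\sum_(eta <- msupp x) x@_eta * (set_word (S :\: V) == eta)%:R)).
  rewrite (eq_big_seq (fun beta =>
     \sum_(V : {set 'I_n} | (V \subset S) && openable chi k V (S :\: V))
     kappa_word kappa z beta * (b V == beta)%:R *
     (\sum_(eta <- msupp x) x@_eta * (set_word (S :\: V) == eta)%:R))); last first.
    move=> beta; rewrite mem_filter => /andP[b0 _].
    rewrite linext_coeff.
    rewrite (eq_bigr (fun eta => \sum_(V : {set 'I_n} | (V \subset S) && openable chi k V (S :\: V))
      x@_eta * ((b V == beta)%:R * (set_word (S :\: V) == eta)%:R))); last first.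
      by move=> eta _; rewrite T_basis_subsets // mulr_sumr.
    rewrite exchange_big mulr_sumr; apply: eq_bigr => V _.
    rewrite !mulr_sumr; apply: eq_bigr => eta _.
    by rewrite -!mulrA [x@_eta * _]mulrCA.
  by rewrite exchange_big; apply: eq_bigr => V _; rewrite mulr_suml.
apply: eq_bigr => V /andP[VS _]; rewrite !sum_delta ?short_words_uniq ?fset_uniq //.
congr (_ * _); last by case: ifPn => // /mcoeff_outdom.
rewrite mem_short_words //.
- rewrite -size_eq0 size_map -cardE cards_eq0.
  by apply/set0Pn; exists k; rewrite setU11.
- by rewrite !size_map -enumT size_enum_ord -cardE -[X in (_ <= X)%N](card_ord n) max_card.
by move=> _ /mapP[i _ ->]; apply: map_f; rewrite mem_enum.
Qed.

Lemma Ztrunc_coeff (a : K) (x : fock R K) w :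
  (Ztrunc kappa z B a x)@_w =
  x@_(a :: w) + \sum_(beta <- B) kappa_word kappa z beta * (T_op beta x)@_(a :: w).
Proof.
rewrite annihilation_coeff mcoeffD raddf_sum; congr (_ + _); apply: eq_bigr => beta _.
exact: mcoeffZ.
Qed.

(** In terms of the set S of positions open before k+1: if S contains k, the factor is
    L^*; otherwise k is the last element of a new block, and the recursion
    [open_sum_block] matches the expansion of T. *)
Lemma open_sum_step k (x : fock R K) :
  \sum_(S : {set 'I_n} | S \subset below k)
     open_sum chi block_cumulant k S * (Ztrunc kappa z B (alpha k) x)@_(set_word S) =
  \sum_(S : {set 'I_n} | S \subset below k.+1)
     open_sum chi block_cumulant k.+1 S * x@_(set_word S).
Proof.
have kb : k \notin below k by rewrite inE ltnn.
have := big_subsets_setU1 predT (fun S => open_sum chi block_cumulant k.+1 S * x@_(set_word S)) kb.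
rewrite -belowS; under eq_bigl do rewrite andbT.
move=> ->; rewrite addrC.
under eq_bigr do rewrite Ztrunc_coeff mulrDr.
rewrite big_split /=; congr (_ + _).
  apply: eq_big => [S|S Sk]; first by rewrite andbT.
  by rewrite open_sum_below // set_word_setU1.
pose F V S := open_sum chi block_cumulant k (S :|: V) *
  (block_cumulant (k |: V) * x@_(set_word S)).
transitivity (\sum_(S : {set 'I_n} | S \subset below k)
    \sum_(V : {set 'I_n} | (V \subset S) && openable chi k V (S :\: V)) F V (S :\: V)).
  apply: eq_bigr => S Sk; rewrite T_op_subsets // mulr_sumr; apply: eq_bigr => V /andP[VS _].
  by rewrite /F setDUK_sub.
rewrite (big_subsets_split _ (openable chi k)).
apply: eq_big => [S|S Sk]; first by rewrite andbT.
rewrite open_sum_block // mulr_suml; apply: eq_bigr => V _.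
by rewrite /F mulrCA mulrA.
Qed.

Lemma foldr_Ztrunc m (x : fock R K) : (m <= n)%N ->
  (foldr (Ztrunc kappa z B) x (take m [seq alpha i | i <- enum 'I_n]))@_[::] =
  \sum_(S : {set 'I_n} | S \subset below m) open_sum chi block_cumulant m S * x@_(set_word S).
Proof.
elim: m x => [|m IH] x mn.
  rewrite take0 (big_pred1 set0) ?open_sum0 ?set_word0 ?mul1r // => S.
  by rewrite below0 subset0.
pose k := Ordinal mn.
have sz : size [seq alpha i | i <- enum 'I_n] = n by rewrite size_map size_enum_ord.
have nk : nth (alpha k) [seq alpha i | i <- enum 'I_n] m = alpha k.
  by rewrite (nth_map k) ?size_enum_ord //; congr alpha; apply: val_inj; rewrite /= nth_enum_ord.
rewrite (take_nth (alpha k)) ?sz // nk.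
by rewrite foldr_rcons IH ?(ltnW mn) // (open_sum_step k).
Qed.

Lemma omega_Zprod_open_sum :
  omega (Zprod kappa z [seq alpha i | i <- enum 'I_n]) = open_sum chi block_cumulant n set0.
Proof.
rewrite omega_Zprod -[X in foldr _ _ X]take_size size_map size_enum_ord foldr_Ztrunc //.
rewrite (bigD1 set0) ?sub0set //= set_word0 mcoeffUU mulr1 big1 ?addr0 // => S /andP[_ S0].
by rewrite mcoeffU eq_sym set_word_eq0 (negPf S0) mulr0.
Qed.

End Model.

Lemma kappa_cast (R : realType) (A : algType R[i]) (kappa : functionals A) m m'
    (c : 'I_m -> bool) (a : 'I_m -> A) (c' : 'I_m' -> bool) (a' : 'I_m' -> A) (e : m = m') :
  c =1 c' \o cast_ord e -> a =1 a' \o cast_ord e -> kappa m c a = kappa m' c' a'.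
Proof.
case: m' / e c' a' => c' a' /funext -> /funext ->.
by congr (kappa _ _ _); apply/funext => i; rewrite /= cast_ord_id.
Qed.

Lemma block_cumulantE (R : realType) (I J : choiceType) (A : algType R[i])
    (kappa : functionals A) (z : I + J -> A) n (alpha : 'I_n -> I + J) (V : {set 'I_n}) :
  block_cumulant kappa z alpha V =
  kappa #|V| (restr (fun i => side (alpha i)) V) (restr (fun i => z (alpha i)) V).
Proof.
have e : size [seq alpha i | i <- enum V] = #|V| by rewrite size_map -cardE.
have tn i : tnth (in_tuple [seq alpha i | i <- enum V]) i = alpha (enum_val (cast_ord e i)).
  have x0 := enum_val (cast_ord e i).
  rewrite (tnth_nth (alpha x0)) /= (nth_map x0) -?cardE; last by rewrite -[X in (_ < X)%N]e.
  by rewrite (enum_val_nth x0).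
by apply: (kappa_cast _ (e := e)) => i; rewrite /= tn.
Qed.

Theorem theorem6p4p1 (R : realType) (A : algType R[i]) (phi : {scalar A})
    (phi1 : phi 1 = 1) (I J : choiceType) (z : I + J -> A)
    (kappa : functionals A) (kappaP : bifree_cumulants phi kappa) :
  (forall T : fsum R I J, fsum_alg (Z kappa z) T -> vacuum_well_defined T) /\
  (forall (n : nat) (alpha : 'I_n -> I + J), (0 < n)%N ->
     omega (\big[@fsum_mul R I J/@fsum1 R I J]_(i < n) Z kappa z (alpha i)) =
     phi (\prod_(i < n) z (alpha i))).
Proof.
split=> [T /fsum_alg_bounded|n alpha _]; first exact: bounded_well_defined.
case: kappaP => _ /(_ n (fun i => side (alpha i)) (fun i => z (alpha i))) ->.
rewrite Zprod_big omega_Zprod_open_sum.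
rewrite /open_sum; apply: eq_big => [p|p _]; first exact: open_partition_BNC.
by apply: eq_bigr => V _; apply: block_cumulantE.
Qed.
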